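(* Let $n\ge 3$, let $B_n$ be the Artin braid group on $n$ strings with Artin generators $\sigma_1,\dots,\sigma_{n-1}$, let $1\le j\le n-1$, and let $\partial\colon C_n\to B_n$ be the free $B_n$-crossed module on a single generator $[r]$ with $\partial[r]=\sigma_j$. Then the kernel of $\partial\colon C_n\to B_n$ is a central subgroup of $C_n$ and is canonically isomorphic to $\mathrm H_2(B_n)$. Furthermore, for $n=3$ the group $\mathrm H_2(B_n)$ is zero, and for $n\ge 4$ the group $\mathrm H_2(B_n)$ is cyclic of order $2$; when $n\geq 4$ and $j=1$ (that is, $\partial[r]=\sigma_1$), it is generated, as a subgroup of $C_n$ (namely as the kernel of $\partial$), by the element $${}^{\sigma_3}[r]\cdot[r]^{-1}\in C_n .$$ Consequently, for $n\ge 4$, as a crossed module over itself, $B_n$ is generated by $\sigma_1$, subject to the relation $${}^{\sigma_3}\sigma_1=\sigma_1 .$$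
   Context: The braid group $B_n$ is the group with generators $\sigma_1,\dots,\sigma_{n-1}$ and relations $\sigma_i\sigma_j=\sigma_j\sigma_i$ for $|i-j|\ge 2$ and $\sigma_j\sigma_{j+1}\sigma_j=\sigma_{j+1}\sigma_j\sigma_{j+1}$ for $1\le j\le n-2$. $\mathrm H_2(\cdot)$ of a group is integral group homology. A crossed module is a group homomorphism $\partial\colon C\to G$ together with an action of $G$ on $C$ by automorphisms, written $(x,c)\mapsto {}^xc$, such that $\partial({}^xc)=x\,\partial(c)\,x^{-1}$ for $x\in G$, $c\in C$, and $aba^{-1}={}^{\partial a}b$ for $a,b\in C$; one also calls $C$ a $G$-crossed module. A morphism from $\partial\colon C\to G$ to $\delta\colon D\to H$ is a pair of homomorphisms $\beta\colon C\to D$, $\alpha\colon G\to H$ with $\delta\beta=\alpha\partial$ and $\beta({}^xc)={}^{\alpha(x)}\beta(c)$. Given a map $\varphi\colon Y\to C$ from a set $Y$, the crossed module $\partial\colon C\to G$ is free on $\varphi$ (or on $Y$) if for every crossed module $\delta\colon D\to H$, homomorphism $\alpha\colon G\to H$ and map $b\colon Y\to D$ with $\alpha\circ\partial\circ\varphi=\delta\circ b$, there is a unique homomorphism $\beta\colon C\to D$ with $\beta\circ\varphi=b$ such that $(\beta,\alpha)$ is a morphism of crossed modules. Given $G$ and a map $Y\to G$, a free $G$-crossed module on $Y$ with $\partial\circ\varphi$ equal to this map exists and is unique up to canonical isomorphism. Here $Y$ is a one-point set, $\varphi$ has image $[r]$, and $\partial[r]=\sigma_j$. ''$B_n$ as a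 crossed module over itself'' means the identity homomorphism $B_n\to B_n$, with $B_n$ acting on itself by conjugation. The final assertion means: for $n\ge4$, the crossed module $\mathrm{Id}\colon B_n\to B_n$ is the quotient, via $\partial$, of the free $B_n$-crossed module $C_n$ on one generator $[r]$ with $\partial[r]=\sigma_1$ by the smallest normal $B_n$-invariant subgroup of $C_n$ containing ${}^{\sigma_3}[r]\cdot[r]^{-1}$. The canonical isomorphism is obtained as follows. Let $K$ be the presentation 2-complex of the presentation of $B_n$ with generators $\sigma_1,\dots,\sigma_{n-1}$ and relators $\sigma_i\sigma_k\sigma_i^{-1}\sigma_k^{-1}$ for $1\le i<k\le n-1$ with $k-i\ge 2$ and $\sigma_i\sigma_{i+1}\sigma_i\sigma_{i+1}^{-1}\sigma_i^{-1}\sigma_{i+1}^{-1}$ for $1\le i\le n-2$ (one vertex, one 1-cell for each generator, one 2-cell for each relator), and let $L$ be $K$ with one 2-cell attached along the loop $\sigma_j$, so that $L$ is simply connected and $C_n=\pi_2(L,K)$. Then $\pi_2(L)\cong\mathrm H_2(L)\cong \mathrm H_2(K)$ (Hurewicz map and inverse of the map induced by inclusion), and $\ker\partial$ is the cokernel of $\pi_2(K)\to\pi_2(L)$, which is identified with the cokernel $\mathrm H_2(B_n)$ of the Hurewicz map $\pi_2(K)\to\mathrm H_2(K)$. *)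

(* Defs.v *)
From HB Require Import structures.
From mathcomp Require Import all_boot all_algebra.
From mathcomp.classical Require Import boolp.
From mathcomp.multinomials Require Import freeg.

Set Implicit Arguments.
Unset Strict Implicit.
Unset Printing Implicit Defensive.

Import GRing.Theory.

Notation "{ 'ghom' G -> H }" :=
  (UMagmaMorphism.type G%type H%type)
  (at level 0, G at level 98, H at level 99,
   format "{ 'ghom'  G  ->  H }") : type_scope.

(* The letter [(x, true)] stands for the generator [x], [(x, false)] for its
   inverse. *)
Definition word (T : Type) := seq (T * bool).

Record presentation := Presentation {
  gen : choiceType;
  rel_index : choiceType;
  relator : rel_index -> word gen }.

Inductive word_eq (P : presentation) : word (gen P) -> word (gen P) -> Prop :=
| word_eq_refl u : word_eq u u
| word_eq_sym u v : word_eq u v -> word_eq v u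
| word_eq_trans u v w : word_eq u v -> word_eq v w -> word_eq u w
| word_eq_cat u u' v v' : word_eq u u' -> word_eq v v' ->
    word_eq (u ++ v) (u' ++ v')
| word_eq_cancel x b : word_eq [:: (x, b); (x, ~~ b)] [::]
| word_eq_relator c : word_eq (relator c) [::].

Section PresentedGroup.
Variable P : presentation.
Local Notation W := (word (gen P)).

Definition word_equiv (u v : W) : bool := `[< word_eq u v >].

Lemma word_equiv_is_equiv : equiv_class_of word_equiv.
Proof.
split=> [u|u v|v u w].
- by apply/asboolP; apply: word_eq_refl.
- by apply/asboolP/asboolP; apply: word_eq_sym.
- by move=> /asboolP uv /asboolP vw; apply/asboolP; apply: word_eq_trans vw.
Qed.

Canonical word_equiv_equiv := EquivRelPack word_equiv_is_equiv.
Canonical word_equiv_encModRel := defaultEncModRel word_equiv.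

Definition pgroup := {eq_quot word_equiv}%qT.

HB.instance Definition _ : EqQuotient W word_equiv pgroup :=
  EqQuotient.on pgroup.
HB.instance Definition _ := Choice.on pgroup.

Definition pclass (u : W) : pgroup := (\pi_pgroup u)%qT.

Lemma pclassP (u v : W) : pclass u = pclass v <-> word_eq u v.
Proof.
split=> [/eqP|uv]; first by rewrite /pclass eqmodE => /asboolP.
by apply/eqP; rewrite /pclass eqmodE; apply/asboolP.
Qed.

Definition inv_word (u : W) : W := [seq (l.1, ~~ l.2) | l <- rev u].

Definition pone : pgroup := pclass [::].
Definition pmul (x y : pgroup) : pgroup := pclass (repr x ++ repr y).
Definition pinv (x : pgroup) : pgroup := pclass (inv_word (repr x)).

Lemma repr_pclass (u : W) : word_eq (repr (pclass u)) u.
Proof. by apply/pclassP; rewrite /pclass reprK. Qed.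

Lemma pclassK (x : pgroup) : pclass (repr x) = x.
Proof. by rewrite /pclass reprK. Qed.

Lemma inv_word_cat (u v : W) : inv_word (u ++ v) = inv_word v ++ inv_word u.
Proof. by rewrite /inv_word rev_cat map_cat. Qed.

Lemma inv_wordK : involutive inv_word.
Proof.
move=> u; rewrite /inv_word -map_rev revK -map_comp -[RHS]map_id.
by apply: eq_map => -[x b] /=; rewrite negbK.
Qed.

Lemma word_eq_mulV (u : W) : word_eq (u ++ inv_word u) [::].
Proof.
elim: u => [|[x b] u IHu]; first exact: word_eq_refl.
rewrite -cat1s inv_word_cat catA -(catA [:: (x, b)]).
apply: word_eq_trans (word_eq_cancel x b).
rewrite -[X in word_eq _ X]/([:: (x, b)] ++ [:: (x, ~~ b)]).
apply: word_eq_cat (word_eq_refl _); rewrite -[X in word_eq _ X]cats0.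
exact: word_eq_cat (word_eq_refl _) IHu.
Qed.

Lemma word_eq_inv (u v : W) : word_eq u v -> word_eq (inv_word u) (inv_word v).
Proof.
move=> uv; apply: (word_eq_trans (v := inv_word u ++ (v ++ inv_word v))).
  rewrite -[X in word_eq X _]cats0.
  apply: word_eq_cat (word_eq_refl _) _; apply: word_eq_sym.
  exact: word_eq_mulV.
rewrite catA -[X in word_eq _ X]cat0s.
apply: word_eq_cat (word_eq_refl _).
apply: (word_eq_trans (v := inv_word u ++ u)).
  by apply: word_eq_cat (word_eq_refl _) _; apply: word_eq_sym.
by rewrite -{2}(inv_wordK u); apply: word_eq_mulV.
Qed.

Lemma pmulE (u v : W) : pmul (pclass u) (pclass v) = pclass (u ++ v).
Proof. by apply/pclassP; apply: word_eq_cat; apply: repr_pclass. Qed.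

Lemma pinvE (u : W) : pinv (pclass u) = pclass (inv_word u).
Proof. by apply/pclassP; apply: word_eq_inv; apply: repr_pclass. Qed.

Lemma pmulA : associative pmul.
Proof.
by move=> x y z; rewrite -(pclassK x) -(pclassK y) -(pclassK z) !pmulE catA.
Qed.

Lemma pmul1 : left_id pone pmul.
Proof. by move=> x; rewrite -(pclassK x) pmulE. Qed.

Lemma pmulr1 : right_id pone pmul.
Proof. by move=> x; rewrite -(pclassK x) pmulE cats0. Qed.

Lemma pmulrV : right_inverse pone pinv pmul.
Proof.
move=> x; rewrite -(pclassK x) pinvE pmulE.
by apply/pclassP; apply: word_eq_mulV.
Qed.

Lemma pmulV : left_inverse pone pinv pmul.
Proof.
move=> x; rewrite -(pclassK x) pinvE pmulE.
by apply/pclassP; rewrite -{2}(inv_wordK (repr x)); apply: word_eq_mulV.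
Qed.

HB.instance Definition _ := isGroup.Build pgroup pmulA pmul1 pmulr1 pmulV pmulrV.

Definition pgen (x : gen P) : pgroup := pclass [:: (x, true)].

End PresentedGroup.

Definition signed (G : groupType) (x : G) (e : bool) : G :=
  (if e then x else x^-1)%g.

Definition weval (G : groupType) (T : Type) (f : T -> G) (w : word T) : G :=
  (\prod_(l <- w) signed (f l.1) l.2)%g.

Definition free_presentation (T : choiceType) : presentation :=
  @Presentation T void (fun c => match c with end).

Definition free_group (T : choiceType) := pgroup (free_presentation T).

Definition free_gen (T : choiceType) (x : T) : free_group T :=
  pgen (P := free_presentation T) x.

Section Braid.
Variable n : nat.

(* One relator for each pair [i < k]: [s_i s_k s_i s_k^-1 s_i^-1 s_k^-1] when
   [k = i + 1], and [s_i s_k s_i^-1 s_k^-1] otherwise.  Generators are indexed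
   from [0], so [i : 'I_n.-1] is the index of the Artin generator
   [sigma_(i + 1)]. *)
Definition braid_rel : choiceType := {p : 'I_n.-1 * 'I_n.-1 | p.1 < p.2}.

Definition braid_relator (c : braid_rel) : word 'I_n.-1 :=
  let: (i, k) := val c in
  if k == i.+1 :> nat then
    [:: (i, true); (k, true); (i, true); (k, false); (i, false); (k, false)]
  else [:: (i, true); (k, true); (i, false); (k, false)].

Definition braid_presentation : presentation := Presentation braid_relator.

Definition braid_group := pgroup braid_presentation.

Definition sigma (i : 'I_n.-1) : braid_group := pgen (P := braid_presentation) i.

End Braid.

Section Homology.
Local Open Scope ring_scope.
Variables (A B C : zmodType) (f : {additive A -> B}) (g : {additive B -> C}).

Definition is_cycle : {pred B} := [pred z | g z == 0].

Lemma is_cycle_zmod_closed : zmod_closed is_cycle.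
Proof.
split=> [|x y]; rewrite !inE ?raddf0 // => /eqP gx /eqP gy.
by rewrite raddfB gx gy subrr.
Qed.
HB.instance Definition _ := GRing.isZmodClosed.Build B is_cycle
  is_cycle_zmod_closed.

Record hcycle := Cycle { cycle_val :> B; cycleP : cycle_val \in is_cycle }.
HB.instance Definition _ := [isSub for cycle_val].
HB.instance Definition _ := [Choice of hcycle by <:].
HB.instance Definition _ := [SubChoice_isSubZmodule of hcycle by <:].

Definition is_boundary : {pred hcycle} :=
  [pred z : hcycle | `[< exists a, f a = val z >]].

Lemma is_boundary_zmod_closed : zmod_closed is_boundary.
Proof.
split=> [|x y]; rewrite !inE.
  by apply/asboolP; exists 0; rewrite raddf0 raddf0.
move=> /asboolP[a fa] /asboolP[b fb]; apply/asboolP.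
by exists (a - b); rewrite !raddfB fa fb.
Qed.
HB.instance Definition _ := GRing.isZmodClosed.Build hcycle is_boundary
  is_boundary_zmod_closed.

Definition homology := Quotient.quot is_boundary.
HB.instance Definition _ := GRing.Zmodule.on homology.

Definition homology_class (h : homology) (b : B) : Prop :=
  exists2 z : hcycle, val z = b & h = (\pi_homology z)%qT.

End Homology.

Section FreegLift.
Local Open Scope ring_scope.
Variables (K : choiceType) (M : lmodType int) (f : K -> M).
Definition freeg_lift : {freeg K / int} -> M := fglift f.
HB.instance Definition _ := GRing.isZmodMorphism.Build {freeg K / int} M freeg_lift
  (lift_is_additive f).
End FreegLift.

Section GroupHomology.
Local Open Scope ring_scope.
Variable G : groupType.

Definition bar1 := {freeg G / int}.
Definition bar2 := {freeg (G * G)%type / int}.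
Definition bar3 := {freeg (G * G * G)%type / int}.

Definition bar_d2 : {additive bar2 -> bar1} :=
  freeg_lift (fun x => << x.2 >> - << (x.1 * x.2)%g >> + << x.1 >>).

Definition bar_d3 : {additive bar3 -> bar2} :=
  freeg_lift (fun x => let: (a, b, c) := x in
    << (b, c) >> - << ((a * b)%g, c) >> + << (a, (b * c)%g) >> - << (a, b) >>).

Definition H2 : zmodType := homology bar_d3 bar_d2.

End GroupHomology.

Definition cyclic_of_order (m : nat) (A : zmodType) : Prop :=
  exists a : A, (forall x : A, exists k : int, x = (a *~ k)%R)
    /\ (forall k : int, (a *~ k)%R = 0%R <-> (m %| k)%Z).

Section Xmod.
Local Open Scope group_scope.

Record xmod (G : groupType) := Xmod {
  xmod_group :> groupType;
  bd : {ghom xmod_group -> G};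
  act : G -> xmod_group -> xmod_group;
  act1g : forall c, act 1 c = c;
  actMg : forall x y c, act (x * y) c = act x (act y c);
  act_mulg : forall x c d, act x (c * d) = act x c * act x d;
  bd_act : forall x c, bd (act x c) = x * bd c * x^-1;
  peiffer : forall a b, a * b * a^-1 = act (bd a) b }.

Definition xmod_morphism (G H : groupType) (C : xmod G) (D : xmod H)
    (beta : {ghom C -> D}) (alpha : {ghom G -> H}) : Prop :=
  (forall c, bd D (beta c) = alpha (bd C c))
  /\ (forall x c, beta (act x c) = act (alpha x) (beta c)).

Definition xmod_free (G : groupType) (C : xmod G) (Y : Type) (phi : Y -> C) :
    Prop :=
  forall (H : groupType) (D : xmod H) (alpha : {ghom G -> H}) (b : Y -> D),
    (forall y, alpha (bd C (phi y)) = bd D (b y)) ->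
    let extends (beta : {ghom C -> D}) :=
      (forall y, beta (phi y) = b y) /\ xmod_morphism beta alpha in
    exists2 beta : {ghom C -> D}, extends beta
      & forall beta' : {ghom C -> D}, extends beta' -> beta' =1 beta.

Section SelfXmod.
Variable G : groupType.
Definition conj_act (x c : G) : G := x * c * x^-1.
Fact conj_act1 c : conj_act 1 c = c.
Proof. by rewrite /conj_act mul1g invg1 mulg1. Qed.
Fact conj_actM x y c : conj_act (x * y) c = conj_act x (conj_act y c).
Proof. by rewrite /conj_act invgM !mulgA. Qed.
Fact conj_act_mul x c d : conj_act x (c * d) = conj_act x c * conj_act x d.
Proof. by rewrite /conj_act !mulgA mulgVK. Qed.
Definition self_xmod : xmod G :=
  @Xmod G G (idfun : {ghom G -> G}) conj_act conj_act1 conj_actM conj_act_mul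
    (fun _ _ => erefl) (fun _ _ => erefl).
End SelfXmod.

Section Subgroups.
Variables (G : groupType) (C : xmod G).
Implicit Types (N S : C -> Prop).

Definition is_subgroup N : Prop :=
  [/\ N 1, forall c d, N c -> N d -> N (c * d) & forall c, N c -> N c^-1].

Definition generated_subgroup S (c : C) : Prop :=
  forall N, is_subgroup N -> (forall d, S d -> N d) -> N c.

(* The smallest normal [G]-invariant subgroup containing [S]. *)
Definition normal_closure S (c : C) : Prop :=
  forall N, is_subgroup N ->
    (forall d e, N e -> N (d * e * d^-1)) ->
    (forall x e, N e -> N (act x e)) ->
    (forall d, S d -> N d) -> N c.

(* [D] is the quotient of [C] by [N], with [beta] as quotient map. *)
Definition xmod_quotient N (D : xmod G) (beta : {ghom C -> D}) : Prop :=
  [/\ xmod_morphism beta (idfun : {ghom G -> G}),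
      forall d, exists c, beta c = d
    & forall c, beta c = 1 <-> N c].

Definition kernel (c : C) : Prop := bd C c = 1.

End Subgroups.
End Xmod.

(* [K] is the presentation complex of [P], [L] is [K] with a 2-cell attached
   along [w], [C] plays the role of [pi_2(L,K)], and [r] that of the class of
   the attached 2-cell.  By Whitehead's theorem, [pi_2(L, L^1)] is the free
   crossed module over the free group [pi_1(L^1)] on the 2-cells of [L], and
   [pi_2(L)] is the kernel of its boundary map: an element of [pi_2(L)] is
   represented by an identity among relators, i.e. by a sequence of entries
   [(u, c, e)], each standing for [^u c^(+-1)], whose boundary
   [prod u (relator c)^(+-1) u^-1] is trivial in the free group. *)
Section Canonical.
Local Open Scope ring_scope.
Variables (P : presentation) (w : word (gen P)).
Variables (C : xmod (pgroup P)) (r : C).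

Definition attach : presentation :=
  @Presentation (gen P) (option (rel_index P)) (oapp (@relator P) w).

Definition spherical := seq (word (gen P) * rel_index attach * bool).

Definition sph_boundary (Q : spherical) : free_group (gen P) :=
  (\prod_(q <- Q) let: (u, c, e) := q in
     weval (@free_gen _) u *
     signed (weval (@free_gen _) (relator c)) e *
     (weval (@free_gen _) u)^-1)%g.

(* The map [pi_2(L) -> pi_2(L, K)], which kills the 2-cells of [K]. *)
Definition sph_push (Q : spherical) : C :=
  (\prod_(q <- Q) let: (u, c, e) := q in
     if c is None then act (weval (@pgen P) u) (signed r e) else 1)%g.

(* The Hurewicz map [pi_2(L) -> H_2(L)], in cellular chains. *)
Definition sph_hurewicz (Q : spherical) : {freeg (rel_index attach) / int} :=
  \sum_(q <- Q) let: (u, c, e) := q in << (if e then 1 else -1) *g c >>.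

Definition cell_d2 : {freeg (rel_index P) / int} -> {freeg (gen P) / int} :=
  freeg_lift (fun c => \sum_(l <- relator c)
    << (if l.2 then 1 else -1) *g l.1 >>).

Definition cell_incl : {freeg (rel_index P) / int} -> {freeg (rel_index attach) / int} :=
  freeg_lift (fun c => << (Some c : rel_index attach) >>).

(* The image in the bar complex of the Fox derivatives of a relator: if [p] is
   the prefix preceding a letter [x] (resp. [x^-1]), that letter contributes
   [[p | x]] (resp. [- [p x^-1 | x]]). *)
Fixpoint bar_chain (p : pgroup P) (v : word (gen P)) : bar2 (pgroup P) :=
  match v with
  | [::] => 0
  | (x, true) :: v' => << (p, pgen x) >> + bar_chain (p * pgen x)%g v'
  | (x, false) :: v' =>
      - << ((p * (pgen x)^-1)%g, pgen x) >> + bar_chain (p * (pgen x)^-1)%g v'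
  end.

(* The chain map inducing [H_2(K) -> H_2(pi_1(K))], whose kernel is the image of
   the Hurewicz map of [K]. *)
Definition cell_to_bar : {freeg (rel_index P) / int} -> bar2 (pgroup P) :=
  freeg_lift (fun c => bar_chain 1%g (relator c)).

(* [c] is the image of an element of [pi_2(L)] whose Hurewicz class in [H_2(L)]
   comes from a class in [H_2(K)] mapping to [h]. *)
Definition canonical_rel (h : H2 (pgroup P)) (c : C) : Prop :=
  exists (Q : spherical) (z : {freeg (rel_index P) / int}),
    [/\ sph_boundary Q = 1%g, sph_push Q = c, cell_d2 z = 0,
        sph_hurewicz Q = cell_incl z
      & homology_class h (cell_to_bar z)].

Definition canonical_iso (iso : H2 (pgroup P) -> C) : Prop :=
  [/\ forall x y, iso (x + y) = (iso x * iso y)%g,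
      injective iso,
      forall c, kernel c <-> exists h, iso h = c
    & forall h c, canonical_rel h c <-> iso h = c].

End Canonical.

(* Main.v *)
(* Let [B] be the braid group and [E] the central extension of [B] by
   [M = bar2 / d3 bar3] with cocycle [(x, y) |-> [x | y]]; it is a crossed
   module over [B], and every set-theoretic section with central defects extends
   to a homomorphism on [E].  By freeness there is a morphism [beta : C -> E]
   with [beta r = (0, sigma_j)].  Two morphisms over [B] out of [C] agree on
   [ker bd], because they differ by a homomorphism [B -> ker] composed with
   [bd]; applied to a retraction [E -> C] this makes [beta] injective, and
   applied to [E -> bar1 x B] it shows that [beta] maps [ker bd] to cycles.
   Conversely, cycles lie in the subgroup of [E] generated by the conjugates of
   [(0, sigma_j)], so [beta] identifies [ker bd] with [H2 B].  Evaluating an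
   identity among relators in [E] shows that this is, up to sign, the canonical
   isomorphism.
   To compute the kernel, lift [sigma_(k+1)] to the conjugate of the lift of
   [sigma_k] by [sigma_k sigma_(k+1)]: the relations of length 3 then hold
   exactly, and the commutators of the lifts of distant generators are central,
   all equal up to conjugation, and equal to their own inverse.  The commutator
   is nontrivial because differences of consecutive Clifford generators satisfy
   the braid relations with distant generators anticommuting. *)

Require Import Defs.
From HB Require Import structures.
From mathcomp Require Import all_boot all_algebra.
From mathcomp.classical Require Import boolp.
From mathcomp.multinomials Require Import freeg.

Set Implicit Arguments.
Unset Strict Implicit.
Unset Printing Implicit Defensive.

Import GRing.Theory.

Local Open Scope group_scope.

Section GroupMorphism.
Variables (G H : groupType) (f : G -> H).
Hypothesis fM : {morph f : x y / x * y}.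

Fact ghom_divg : {morph f : x y / x / y}.
Proof.
have f1 : f 1 = 1 by apply: (mulgI (f 1)); rewrite -fM !mulg1.
move=> x y; rewrite fM; congr (_ * _).
by apply/esym/mulg1_eq; rewrite -fM mulgV.
Qed.

Definition mk_ghom : {ghom G -> H} :=
  HB.pack_for {ghom G -> H} f (isGroupMorphism.Build G H f ghom_divg).

Lemma mk_ghomE x : mk_ghom x = f x. Proof. by []. Qed.
End GroupMorphism.

(** * Words and crossed modules *)

Section WordEvaluation.
Variables (P : presentation) (G : groupType) (f : gen P -> G).
Implicit Types u v : word (gen P).

Lemma weval_nil : weval f [::] = 1.
Proof. exact: big_nil. Qed.

Lemma weval_cons l u : weval f (l :: u) = signed (f l.1) l.2 * weval f u.
Proof. exact: big_cons. Qed.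

Lemma weval_cat u v : weval f (u ++ v) = weval f u * weval f v.
Proof. exact: big_cat. Qed.

Lemma weval_inv u : weval f (inv_word u) = (weval f u)^-1.
Proof.
elim: u => [|[x b] u IHu]; first by rewrite /inv_word /= !weval_nil invg1.
rewrite -cat1s inv_word_cat !weval_cat IHu invgM; congr (_ * _).
by rewrite !weval_cons weval_nil !mulg1; case: b; rewrite //= invgK.
Qed.

Definition normal_pred (N : G -> Prop) : Prop :=
  [/\ N 1, forall x y, N x -> N y -> N (x * y), forall x, N x -> N x^-1
    & forall x y, N y -> N (x * y * x^-1)].

(** Three choices of [N] matter: the trivial subgroup gives the universal property of a
    presentation, a central subgroup handles lifts that satisfy the relations up to a defect, and
    the boundaries over the old cells produce identities among relators. *)
Lemma word_eq_mod (N : G -> Prop) u v :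
    normal_pred N -> (forall c, N (weval f (relator c))) ->
  word_eq u v -> N (weval f u * (weval f v)^-1).
Proof.
move=> [N1 NM NV NJ] Nrel; elim=> {u v} [u|u v _ Nuv|u v w _ Nuv _ Nvw
  |u u' v v' _ Nu _ Nv|x b|c].
- by rewrite mulgV.
- by have := NV _ Nuv; rewrite invgM invgK.
- by have := NM _ _ Nuv Nvw; rewrite mulgA mulgVK.
(* Here [u v (u' v')^-1 = u (v v'^-1) u^-1 * (u u'^-1)]. *)
- rewrite !weval_cat invgM.
  by have := NM _ _ (NJ (weval f u) _ Nv) Nu; rewrite !mulgA !mulgVK.
- rewrite !weval_cons !weval_nil mulg1 invg1 mulg1 /=.
  by case: b => /=; rewrite ?mulgV ?mulVg.
- by rewrite weval_nil invg1 mulg1.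
Qed.

Lemma word_eq_weval u v : (forall c, weval f (relator c) = 1) ->
  word_eq u v -> weval f u = weval f v.
Proof.
move=> frel uv; suff : weval f u * (weval f v)^-1 = 1 by move/divg1_eq.
apply: (word_eq_mod (N := fun x => x = 1)) uv => //.
split=> [//|x y -> ->|x ->|x y ->].
- by rewrite mulg1.
- by rewrite invg1.
- by rewrite mulg1 mulgV.
Qed.

Lemma pgroup_lift : (forall c, weval f (relator c) = 1) ->
  exists h : {ghom pgroup P -> G}, forall u, h (pclass u) = weval f u.
Proof.
move=> frel; pose h (x : pgroup P) := weval f (repr x).
have hE u : h (pclass u) = weval f u by apply: word_eq_weval (repr_pclass u).
have hM : {morph h : x y / x * y}.
  move=> x y; rewrite -(pclassK x) -(pclassK y) -[_ * _]/(pmul _ _) pmulE !hE.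
  exact: weval_cat.
by exists (mk_ghom hM).
Qed.

End WordEvaluation.

Lemma pclass_cat (P : presentation) (u v : word (gen P)) :
  pclass (u ++ v) = pclass u * pclass v.
Proof. by rewrite -[RHS]/(pmul _ _) pmulE. Qed.

Lemma pclass_inv (P : presentation) (u : word (gen P)) :
  pclass (inv_word u) = (pclass u)^-1.
Proof. by rewrite -[RHS]/(pinv _) pinvE. Qed.

Lemma weval_pgen (P : presentation) (u : word (gen P)) :
  weval (@pgen P) u = pclass u.
Proof.
elim: u => [|[x b] u IHu]; first exact: weval_nil.
rewrite weval_cons IHu -cat1s pclass_cat; congr (_ * _).
by case: b => //=; rewrite /pgen -pclass_inv.
Qed.

Lemma pclass_relator (P : presentation) (c : rel_index P) :
  pclass (relator c) = 1.
Proof. exact/pclassP/word_eq_relator. Qed.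

Lemma ghom_weval (G H : groupType) (h : {ghom G -> H}) T (f : T -> G) w :
  h (weval f w) = weval (h \o f) w.
Proof.
by rewrite gmulf_prod; apply: eq_bigr => -[x []] _ //=; rewrite gmulfV.
Qed.

Section XmodTheory.
Variables (G : groupType) (C : xmod G).
Implicit Types (c d : C) (x y : G).

Lemma act_g1 x : act x (1 : C) = 1.
Proof. by apply: (mulgI (act x (1 : C))); rewrite -act_mulg !mulg1. Qed.

Lemma act_invg x c : act x c^-1 = (act x c)^-1.
Proof. by apply/esym/mulg1_eq; rewrite -act_mulg mulgV act_g1. Qed.

Lemma kernel_central c d : kernel c -> c * d = d * c.
Proof.
by move=> c_ker; apply: (mulIg c^-1); rewrite peiffer c_ker act1g mulgK.
Qed.

Lemma kernel_subgroup : is_subgroup (@kernel G C).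
Proof.
split; rewrite /kernel ?gmulf1 //.
- by move=> c d cK dK; rewrite gmulfM cK dK mulg1.
- by move=> c cK; rewrite gmulfV cK invg1.
Qed.

Lemma act_bd_kernel c d : kernel d -> act (bd C c) d = d.
Proof. by move=> dK; rewrite -peiffer -(kernel_central c dK) mulgK. Qed.

End XmodTheory.

Section Generated.
Variables (P : presentation) (C : xmod (pgroup P)) (r : C).

(** Conjugators are kept as words, so that such a list becomes a spherical sequence by inserting the
    index [None] of the attached cell. *)
Definition conj_prod (s : seq (word (gen P) * bool)) : C :=
  \prod_(q <- s) act (weval (@pgen P) q.1) (signed r q.2).

Definition generated_by (c : C) : Prop := exists s, c = conj_prod s.

Lemma generated1 : generated_by 1.
Proof. by exists [::]; rewrite /conj_prod big_nil. Qed.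

Lemma generatedM c d : generated_by c -> generated_by d -> generated_by (c * d).
Proof.
by move=> [s ->] [t ->]; exists (s ++ t); rewrite /conj_prod big_cat.
Qed.

Lemma generated_gen : generated_by r.
Proof.
by exists [:: ([::], true)]; rewrite /conj_prod big_seq1 /= weval_nil act1g.
Qed.

Lemma generated_act x c : generated_by c -> generated_by (act x c).
Proof.
case=> s ->; exists [seq (repr x ++ q.1, q.2) | q <- s].
rewrite /conj_prod big_map; elim: s => [|q s IHs].
  by rewrite !big_nil act_g1.
rewrite !big_cons act_mulg IHs; congr (_ * _).
by rewrite weval_cat actMg !weval_pgen pclassK.
Qed.

Lemma generatedV c : generated_by c -> generated_by c^-1.
Proof.
case=> s ->; elim: s => [|q s IHs].
  by rewrite /conj_prod big_nil invg1; apply: generated1.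
rewrite /conj_prod big_cons invgM; apply: generatedM IHs _.
exists [:: (q.1, ~~ q.2)]; rewrite /conj_prod big_seq1 -act_invg.
by case: q.2; rewrite //= invgK.
Qed.

End Generated.

(** * Central extensions *)

Section CocycleExtension.
Local Open Scope ring_scope.
Variables (G : groupType) (M : zmodType) (f : G -> G -> M).

Definition cocycle : Prop := forall x y z : G,
  f y z - f (x * y)%g z + f x (y * z)%g - f x y = 0.

Hypothesis fP : cocycle.

Definition ext of cocycle : Type := (M * G)%type.
Local Notation E := (ext fP).
HB.instance Definition _ := Choice.copy E (M * G)%type.

(** The cocycle is not assumed normalized, so the unit is shifted by [f 1 1]; the same shift appears
    in [ext_incl]. *)
Definition ext_one : E := (- f 1%g 1%g, 1%g).
Definition ext_mul (a b : E) : E := (a.1 + b.1 + f a.2 b.2, (a.2 * b.2)%g).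
Definition ext_inv (a : E) : E :=
  (- a.1 - f a.2 a.2^-1%g - f 1%g 1%g, a.2^-1%g).

Fact cocycle1g y : f 1%g y = f 1%g 1%g.
Proof.
have /eqP := fP 1%g 1%g y.
by rewrite !mul1g subrr add0r subr_eq0 => /eqP.
Qed.

Fact cocycleg1 x : f 1%g 1%g = f x 1%g.
Proof.
by have /eqP := fP x 1%g 1%g; rewrite !mulg1 subrK subr_eq0 => /eqP.
Qed.

Fact cocyclegV x : f x^-1%g x = f x x^-1%g.
Proof.
have /eqP := fP x x^-1%g x.
by rewrite mulgV mulVg cocycle1g -cocycleg1 subrK subr_eq0 => /eqP.
Qed.

Fact ext_mulA : associative ext_mul.
Proof.
move=> [m x] [m' y] [m'' z]; rewrite /ext_mul /= mulgA; congr (_, _).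
have /eqP := fP x y z; rewrite subr_eq0 addrAC subr_eq => /eqP fxyz.
rewrite !addrA -[LHS]addrA fxyz -!addrA; do 2!congr (_ + _).
exact: addrCA.
Qed.

Fact ext_mul1 : left_id ext_one ext_mul.
Proof.
by move=> [m x]; rewrite /ext_mul /= cocycle1g mul1g addrAC addNr add0r.
Qed.

Fact ext_mulr1 : right_id ext_one ext_mul.
Proof. by move=> [m x]; rewrite /ext_mul /= -cocycleg1 mulg1 subrK. Qed.

Fact ext_mulrV : right_inverse ext_one ext_inv ext_mul.
Proof.
move=> [m x]; rewrite /ext_mul /ext_one /= mulgV; congr (_, _).
by rewrite !addrA subrr add0r addrAC addNr add0r.
Qed.

Fact ext_mulV : left_inverse ext_one ext_inv ext_mul.
Proof.
move=> [m x]; rewrite /ext_mul /ext_one /= mulVg cocyclegV; congr (_, _).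
by rewrite -[LHS]addrA -opprD addrAC addNr add0r.
Qed.

HB.instance Definition _ :=
  isGroup.Build E ext_mulA ext_mul1 ext_mulr1 ext_mulV ext_mulrV.

Definition ext_lift (x : G) : E := (0, x).
Definition ext_incl (m : M) : E := (m - f 1%g 1%g, 1%g).

Lemma ext_prodE (a b : E) : (a * b)%g = (a.1 + b.1 + f a.2 b.2, (a.2 * b.2)%g).
Proof. by []. Qed.

Lemma ext_incl_mull m (a : E) : (ext_incl m * a)%g = (m + a.1, a.2).
Proof. by rewrite ext_prodE /= cocycle1g mul1g addrAC subrK. Qed.

Lemma ext_incl_mulr m (a : E) : (a * ext_incl m)%g = (m + a.1, a.2).
Proof. by rewrite ext_prodE /= -cocycleg1 mulg1 addrA subrK addrC. Qed.

Lemma ext_inclC m (a : E) : (ext_incl m * a = a * ext_incl m)%g.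
Proof. by rewrite ext_incl_mull ext_incl_mulr. Qed.

Lemma ext_inclD m m' : ext_incl (m + m') = (ext_incl m * ext_incl m')%g.
Proof. by rewrite ext_incl_mull /ext_incl addrA. Qed.

Lemma ext_incl0 : ext_incl 0 = 1%g.
Proof. by rewrite /ext_incl sub0r. Qed.

Lemma ext_inclN m : ext_incl (- m) = ((ext_incl m)^-1)%g.
Proof. by apply/esym/mulg1_eq; rewrite -ext_inclD subrr ext_incl0. Qed.

Lemma ext_incl_inj : injective ext_incl.
Proof. by move=> m m' [/addIr]. Qed.

Lemma ext_inclP (a : E) : a.2 = 1%g -> exists m, a = ext_incl m.
Proof.
by case: a => m x /= ->; exists (m + f 1%g 1%g); rewrite /ext_incl addrK.
Qed.

Lemma ext_decomp (a : E) : a = (ext_incl a.1 * ext_lift a.2)%g.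
Proof. by rewrite ext_incl_mull /= addr0; case: a. Qed.

Lemma ext_lift1 : ext_lift 1%g = ext_incl (f 1%g 1%g).
Proof. by rewrite /ext_incl subrr. Qed.

Lemma ext_liftM x y :
  (ext_lift x * ext_lift y = ext_incl (f x y) * ext_lift (x * y))%g.
Proof. by rewrite ext_incl_mull ext_prodE /= !addr0 add0r. Qed.

Local Open Scope group_scope.

Fact ext_sndM : {morph (fun a : E => a.2 : G) : a b / a * b}.
Proof. by []. Qed.

Definition ext_act (x : G) (a : E) : E := ext_lift x * a * (ext_lift x)^-1.

Fact ext_act1 (a : E) : ext_act 1 a = a.
Proof. by rewrite /ext_act ext_lift1 ext_inclC mulgK. Qed.

(** Conjugation ignores central factors. Hence conjugation by [ext_lift x] is an action although
    [ext_lift] is not multiplicative, and the Peiffer identity follows. *)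
Fact ext_conj_incl m a b :
  ext_incl m * a * b * (ext_incl m * a)^-1 = a * b * a^-1.
Proof.
rewrite invgM mulgA -ext_inclN -(ext_inclC (- m)%R) !mulgA -ext_inclD.
by rewrite addNr ext_incl0 mul1g.
Qed.

Fact ext_actM x y (a : E) : ext_act (x * y) a = ext_act x (ext_act y a).
Proof.
rewrite /ext_act -(ext_conj_incl (f x y)) -ext_liftM.
by rewrite invgM !mulgA.
Qed.

Fact ext_act_mul x (a b : E) : ext_act x (a * b) = ext_act x a * ext_act x b.
Proof. by rewrite /ext_act !mulgA mulgVK. Qed.

Fact ext_bd_act x (a : E) : (ext_act x a).2 = x * a.2 * x^-1.
Proof. by []. Qed.

Fact ext_peiffer (a b : E) : a * b * a^-1 = ext_act a.2 b.
Proof. by rewrite {1 2}(ext_decomp a) ext_conj_incl. Qed.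

Definition ext_xmod : xmod G :=
  @Xmod G E (mk_ghom ext_sndM) ext_act ext_act1 ext_actM ext_act_mul ext_bd_act
    ext_peiffer.

End CocycleExtension.

Section FreegInduction.
Local Open Scope ring_scope.
Variable K : choiceType.

Lemma freeg_ind (A : {freeg K / int} -> Prop) :
    A 0 -> (forall a b, A a -> A b -> A (a + b)) ->
    (forall a, A a -> A (- a)) ->
  (forall x, A << x >>) -> forall a, A a.
Proof.
move=> A0 AD AN A1; elim/freeg_ind_dom0 => // k x a _ _ Aa; apply: (AD) => //.
rewrite -[k]intz -freegU_mulz; have An n : A (<< x >> *+ n).
  by elim: n => [|n IHn]; rewrite ?mulr0n // mulrS; apply: (AD).
by case: k => n; [apply: An | rewrite NegzE mulrNz; apply: (AN); apply: An].
Qed.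

Lemma eq_freeg_additive (M : zmodType) (f g : {freeg K / int} -> M) :
    zmod_morphism f -> zmod_morphism g -> (forall x, f << x >> = g << x >>) ->
  f =1 g.
Proof.
move=> fB gB fg.
pose f' : {additive _ -> _} := HB.pack f (GRing.isZmodMorphism.Build _ _ f fB).
pose g' : {additive _ -> _} := HB.pack g (GRing.isZmodMorphism.Build _ _ g gB).
elim/freeg_ind => [|a b fga fgb|a fga|//].
- by rewrite -[f 0]/(f' 0) -[g 0]/(g' 0) !raddf0.
- by rewrite -[LHS]/(f' _) -[RHS]/(g' _) !raddfD /= fga fgb.
- by rewrite -[LHS]/(f' _) -[RHS]/(g' _) !raddfN /= fga.
Qed.

Lemma freeg_liftU (M : lmodType int) (f : K -> M) x :
  freeg_lift f << x >> = f x.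
Proof. by rewrite /freeg_lift liftU scale1r. Qed.

Lemma freeg_lift_sg (M : lmodType int) (f : K -> M) (e : bool) x :
  freeg_lift f << (if e then 1 else -1) *g x >> = (if e then f x else - f x).
Proof. by rewrite /freeg_lift liftU; case: e; rewrite ?scale1r ?scaleN1r. Qed.

End FreegInduction.

Section CentralSubgroup.
Local Open Scope ring_scope.
Variables (H : groupType) (K : H -> Prop).

Definition central_pred : Prop :=
  [/\ K 1%g, forall x y, K x -> K y -> K (x * y)%g, forall x, K x -> K (x^-1)%g
    & forall x y, K x -> (x * y = y * x)%g].

Hypothesis KP : central_pred.

(** The central subgroup is made additive in order to receive linear maps from free abelian
    groups. *)
Definition csub of central_pred : Type := {x : H | `[< K x >]}.
Local Notation Z := (csub KP).
HB.instance Definition _ := Choice.copy Z {x : H | `[< K x >]}.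

Definition Csub (x : H) (Kx : K x) : Z := exist _ x (asboolT Kx).
Definition csub_val (z : Z) : H := val z.
Lemma csubP (z : Z) : K (csub_val z).
Proof. exact/asboolP/(valP z). Qed.

Lemma csub_inj : injective csub_val. Proof. exact: val_inj. Qed.

Definition csub0 : Z := let: And4 K1 _ _ _ := KP in Csub K1.
Definition csub_opp (z : Z) : Z :=
  let: And4 _ _ KV _ := KP in Csub (KV _ (csubP z)).
Definition csub_add (y z : Z) : Z :=
  let: And4 _ KM _ _ := KP in Csub (KM _ _ (csubP y) (csubP z)).

Lemma csub_val0 : csub_val csub0 = 1%g.
Proof. by rewrite /csub0; case: KP. Qed.
Lemma csub_valN z : csub_val (csub_opp z) = ((csub_val z)^-1)%g.
Proof. by rewrite /csub_opp; case: KP. Qed.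
Lemma csub_valD y z : csub_val (csub_add y z) = (csub_val y * csub_val z)%g.
Proof. by rewrite /csub_add; case: KP. Qed.

Lemma csub_valC y (x : H) : (csub_val y * x = x * csub_val y)%g.
Proof. by case: KP => _ _ _; apply; apply: csubP. Qed.

Fact csub_addA : associative csub_add.
Proof. by move=> x y z; apply: csub_inj; rewrite !csub_valD mulgA. Qed.
Fact csub_addC : commutative csub_add.
Proof. by move=> x y; apply: csub_inj; rewrite !csub_valD csub_valC. Qed.
Fact csub_add0 : left_id csub0 csub_add.
Proof. by move=> x; apply: csub_inj; rewrite csub_valD csub_val0 mul1g. Qed.
Fact csub_addN : left_inverse csub0 csub_opp csub_add.
Proof.
by move=> x; apply: csub_inj; rewrite csub_valD csub_valN mulVg csub_val0.
Qed.

HB.instance Definition _ :=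
  GRing.isZmodule.Build Z csub_addA csub_addC csub_add0 csub_addN.

End CentralSubgroup.

(** * The bar extension and its universal property *)

Section BarExtension.
Local Open Scope ring_scope.
Variable G : groupType.

Definition is_bar_boundary : {pred bar2 G} :=
  [pred b | `[< exists a, bar_d3 G a = b >]].

Fact is_bar_boundary_zmod_closed : zmod_closed is_bar_boundary.
Proof.
split=> [|x y]; rewrite !inE; first by apply/asboolP; exists 0; rewrite raddf0.
move=> /asboolP[a <-] /asboolP[b <-]; apply/asboolP.
by exists (a - b); rewrite raddfB.
Qed.
HB.instance Definition _ := GRing.isZmodClosed.Build (bar2 G) is_bar_boundary
  is_bar_boundary_zmod_closed.

(** All 2-chains are kept, not only the cycles, so that [[x|y]] has a class, which is the universal
    2-cocycle; [H2] sits inside as the classes of cycles. *)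
Definition barq := Quotient.quot is_bar_boundary.
HB.instance Definition _ := GRing.Zmodule.on barq.

Definition bar_pi : {additive bar2 G -> barq} := (\pi_barq)%qT.

Lemma bar_piP a b : bar_pi a = bar_pi b <-> exists c, bar_d3 G c = a - b.
Proof.
split=> [/eqP|ex].
  by rewrite -Quotient.idealrBE inE => /asboolP.
by apply/eqP; rewrite -Quotient.idealrBE inE; apply/asboolP.
Qed.

Definition bar_cocycle (x y : G) : barq := bar_pi << (x, y) >>.

Lemma bar_d3U x y z : bar_d3 G << (x, y, z) >> =
  << (y, z) >> - << ((x * y)%g, z) >> + << (x, (y * z)%g) >> - << (x, y) >>.
Proof. exact: freeg_liftU. Qed.

Lemma bar_d2U x y :
  bar_d2 G << (x, y) >> = << y >> - << (x * y)%g >> + << x >>.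
Proof. exact: freeg_liftU. Qed.

Lemma bar_cocycleP : cocycle bar_cocycle.
Proof.
move=> x y z; rewrite -!raddfB -raddfD -raddfB /= -bar_d3U -(raddf0 bar_pi).
by apply/bar_piP; exists << (x, y, z) >>; rewrite subr0.
Qed.

Definition bar_ext := ext bar_cocycleP.
HB.instance Definition _ := Group.on bar_ext.
Definition bar_xmod : xmod G := ext_xmod bar_cocycleP.

End BarExtension.
Arguments bar_cocycleP : clear implicits.

Section BarExtensionLift.
Variables (G H : groupType) (s : G -> H) (K : H -> Prop).
Hypotheses (KP : central_pred K)
  (Ks : forall x y, K (s x * s y * (s (x * y))^-1)).

Local Open Scope ring_scope.

Definition bar_defect (x y : G) : csub KP := Csub KP (Ks x y).

Lemma bar_defectE x y :
  (csub_val (bar_defect x y) * s (x * y) = s x * s y)%g.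
Proof. exact: mulgVK. Qed.

Definition bar_eval : bar2 G -> csub KP :=
  freeg_lift (fun x => bar_defect x.1 x.2 : zmodule (csub KP)).

Fact bar_evalU x y : bar_eval << (x, y) >> = bar_defect x y.
Proof. by rewrite /bar_eval freeg_liftU. Qed.

Fact bar_evalB : zmod_morphism bar_eval.
Proof. by move=> a b; rewrite /bar_eval raddfB. Qed.
HB.instance Definition _ :=
  GRing.isZmodMorphism.Build (bar2 G) (csub KP) bar_eval bar_evalB.

(** Bracketing [s x * s y * s z] in two ways shows that the defects of [s] form a cocycle, which is
    the vanishing on [d3 [x|y|z]]. *)
Fact bar_eval_bnd c : bar_eval (bar_d3 G c) = 0.
Proof.
apply: (eq_freeg_additive (f := bar_eval \o bar_d3 G) (g := fun => 0)) c => //.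
- by move=> a b /=; rewrite raddfB bar_evalB.
- by move=> a b; rewrite subr0.
move=> [[x y] z] /=; rewrite bar_d3U raddfB raddfD raddfB /= !bar_evalU.
apply/eqP; rewrite subr_eq0 addrAC subr_eq; apply/eqP/csub_inj.
rewrite !csub_valD; apply: (mulIg (s (x * y * z)%g)).
rewrite -[LHS]mulgA -[RHS]mulgA bar_defectE -[in LHS](mulgA x) bar_defectE.
by rewrite !mulgA bar_defectE csub_valC -mulgA bar_defectE mulgA.
Qed.

Lemma bar_eval_repr (b : bar2 G) : bar_eval (repr (bar_pi G b)) = bar_eval b.
Proof.
have /bar_piP[c cE] : bar_pi G (repr (bar_pi G b)) = bar_pi G b.
  by rewrite /bar_pi /= reprK.
by apply/eqP; rewrite -subr_eq0 -bar_evalB -cE bar_eval_bnd.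
Qed.

Local Open Scope group_scope.

(** The defects of [s] define a map on chains modulo boundaries; [(m, x)] goes to its value at [m]
    times [s x]. *)
Lemma bar_ext_lift : exists psi : {ghom bar_ext G -> H},
  (forall x, psi (ext_lift (bar_cocycleP G) x) = s x)
  /\ (forall m, K (psi (ext_incl (bar_cocycleP G) m))).
Proof.
pose psi (a : bar_ext G) := csub_val (bar_eval (repr a.1)) * s a.2.
have psiE b x : psi (bar_pi G b, x) = csub_val (bar_eval b) * s x.
  by rewrite /psi bar_eval_repr.
have barE (m : barq G) : exists b, m = bar_pi G b.
  by exists (repr m); rewrite /bar_pi /= reprK.
have bar_evalD a b : bar_eval (a + b)%R = (bar_eval a + bar_eval b)%R.
  by rewrite raddfD.
have psiM : {morph psi : a b / a * b}.
  move=> [m x] [m' y]; have [[b ->] [b' ->]] := (barE m, barE m').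
  rewrite ext_prodE -!raddfD !psiE !bar_evalD !csub_valD /=.
  rewrite bar_evalU -[LHS]mulgA bar_defectE -[LHS]mulgA -[RHS]mulgA.
  by congr (_ * _); rewrite !mulgA csub_valC.
exists (mk_ghom psiM); split=> [x|m]; rewrite mk_ghomE.
  rewrite /ext_lift -(raddf0 (bar_pi G)) psiE raddf0.
  by rewrite [csub_val _]csub_val0 mul1g.
have [b ->] := barE m; rewrite /ext_incl -raddfB psiE.
(* The section need not send 1 to 1, but [s 1] is the defect at [(1, 1)] and so lies in [K]. *)
have -> : s 1 = csub_val (bar_defect 1 1).
  by rewrite /= /csub_val /= mulg1 mulgK.
by rewrite -csub_valD; apply: csubP.
Qed.

End BarExtensionLift.

Notation bar_lift x := (ext_lift (bar_cocycleP _) x : bar_ext _).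
Notation bar_incl m := (ext_incl (bar_cocycleP _) m : bar_ext _).

(** * Invariant subgroups generated by one element *)

Section GeneratedBoundary.
Variables (P : presentation) (C : xmod (pgroup P)) (r : C).

Definition in_image (x : pgroup P) : Prop :=
  exists2 c, generated_by r c & bd C c = x.

Lemma in_imageM x y : in_image x -> in_image y -> in_image (x * y).
Proof.
move=> [c cN <-] [d dN <-]; exists (c * d); rewrite ?gmulfM //.
exact: generatedM.
Qed.

Lemma in_imageV x : in_image x -> in_image x^-1.
Proof.
by move=> [c cN <-]; exists c^-1; rewrite ?gmulfV //; apply: generatedV.
Qed.

Lemma in_imageJ x y : in_image y -> in_image (x * y * x^-1).
Proof.
by move=> [c cN <-]; exists (act x c); rewrite ?bd_act //; apply: generated_act.
Qed.

Lemma in_image_gen : (forall i, in_image (pgen i)) -> forall x, in_image x.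
Proof.
move=> Igen x; rewrite -(pclassK x) -weval_pgen; move: (repr x).
elim=> [|[i b] u IHu].
  by rewrite weval_nil; exists 1; [apply: generated1 | rewrite gmulf1].
rewrite weval_cons; apply: in_imageM IHu; case: b => //=.
exact: in_imageV.
Qed.

Hypothesis image_full : forall x, in_image x.

(** Since [bd] is onto, every action is an inner conjugation, and kernel elements are central. *)
Lemma act_kernel x (c : C) : kernel c -> act x c = c.
Proof. by have [d _ <-] := image_full x; apply: act_bd_kernel. Qed.

End GeneratedBoundary.

(* Two morphisms over the identity differ on the kernel by a homomorphism that
   factors through the boundary, hence agree there. *)
Lemma free_kernel_eq (P : presentation) (C D : xmod (pgroup P)) (r : C)
    (b1 b2 : {ghom C -> D}) (theta : {ghom pgroup P -> D}) :
    xmod_free (fun _ : unit => r) ->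
    (forall x, in_image (b2 r : D) x) ->
    xmod_morphism (C := C) (D := D) b1 idfun ->
    xmod_morphism (C := C) (D := D) b2 idfun ->
    theta (bd C r) = (b2 r)^-1 * b1 r ->
    (forall x, kernel (C := D) (theta x)) ->
  forall c, kernel c -> b1 c = b2 c.
Proof.
move=> Cfree Dfull [b1bd b1act] [b2bd b2act] thr thK.
pose g c : D := b2 c * theta (bd C c).
have gM : {morph g : c d / c * d}.
  move=> c d; rewrite /g !gmulfM -!mulgA; congr (_ * _).
  by rewrite !mulgA (kernel_central _ (thK _)).
have [|beta _ uniq] := Cfree _ D (idfun : {ghom pgroup P -> pgroup P})
  (fun _ => b1 r).
  by move=> _; rewrite b1bd.
have gP : xmod_morphism (C := C) (D := D) (mk_ghom gM) idfun.
  split=> [c|x c]; rewrite !(mk_ghomE gM) /g /=.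
    by rewrite [bd D _]gmulfM b2bd thK mulg1.
  rewrite b2act act_mulg; congr (_ * _); rewrite (act_kernel Dfull) //.
  rewrite bd_act ![theta (_ * _)]gmulfM gmulfV.
  rewrite (kernel_central (theta (bd C c)) (thK x)).
  by rewrite mulgK.
have gr (u : unit) : mk_ghom gM r = b1 r by rewrite (mk_ghomE gM) /g thr mulVKg.
move=> c cK; rewrite (uniq b1) // -(uniq (mk_ghom gM)) // (mk_ghomE gM) /g cK.
by rewrite gmulf1 mulg1.
Qed.

(** Choose chains [mu x] such that [(mu x, x)] is generated by [r], and extend [mu] linearly to
    [lam]. For every chain [b], the corrected chain [b + lam (d2 b)] is then generated; on cycles
    the correction vanishes. *)
Lemma generated_cycle (P : presentation) (r : bar_xmod (pgroup P)) b :
    (forall x, in_image r x) -> bar_d2 (pgroup P) b = 0%R ->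
  generated_by r (bar_incl (bar_pi _ b)).
Proof.
move=> full b0.
have /choice[mu muP] : forall x, exists m : bar2 (pgroup P),
    generated_by r ((bar_pi _ m, x) : bar_ext _).
  move=> x; have [[m y] mN yx] := full x; exists (repr m).
  by rewrite /bar_pi /= reprK -yx.
pose lam : {additive bar1 (pgroup P) -> bar2 (pgroup P)} := freeg_lift mu.
suff : generated_by r (bar_incl (bar_pi _ (b + lam (bar_d2 _ b))%R)).
  by rewrite b0 raddf0 addr0.
elim/freeg_ind: b {b0} => [|a b aN bN|a aN|[x y]].
- by rewrite !raddf0 addr0 raddf0 ext_incl0; apply: generated1.
- have -> : (a + b + lam (bar_d2 _ (a + b))
      = (a + lam (bar_d2 _ a)) + (b + lam (bar_d2 _ b)))%R.
    by rewrite !raddfD addrACA.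
  by rewrite raddfD ext_inclD; apply: generatedM.
- have -> : (- a + lam (bar_d2 _ (- a)) = - (a + lam (bar_d2 _ a)))%R.
    by rewrite !raddfN opprD.
  by rewrite raddfN ext_inclN; apply: generatedV.
have -> : lam (bar_d2 _ << (x, y) >>) = (mu y - mu (x * y)%g + mu x)%R.
  by rewrite bar_d2U raddfD raddfB /= !freeg_liftU.
set m := (_ + _)%R.
(* The corrected chain of [[x|y]] is the defect of the section [x |-> (mu x, x)]. *)
suff -> : bar_incl (bar_pi _ m) = (((bar_pi _ (mu x), x) : bar_ext _)
   * (bar_pi _ (mu y), y) * ((bar_pi _ (mu (x * y)), x * y) : bar_ext _)^-1).
  by apply: generatedM; [apply: generatedM | apply: generatedV].
apply: (mulIg ((bar_pi _ (mu (x * y)), x * y) : bar_ext _)); rewrite mulgVK.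
rewrite ext_incl_mull ext_prodE /=; congr (_, _).
rewrite -!raddfD /m -[X in bar_pi _ X]addrA [X in _ = bar_pi _ X]addrC.
by rewrite [(_ + mu x + _)%R]addrAC subrK [(mu y + _)%R]addrC.
Qed.

(** * Crossed modules over braid groups *)

Section BraidRelations.
Variable m : nat.
Local Notation B := (braid_group m.+3).

(** Natural indices allow induction: [sg k] is sigma_(k+1) for [k < m.+2], and beyond that range
    [inord] falls back to index 0. *)
Definition sg (k : nat) : B := @sigma m.+3 (inord k).

Lemma sg_ord (i : 'I_m.+3.-1) : sg i = sigma i.
Proof. by rewrite /sg inord_val. Qed.

Lemma braid_relatorE (G : groupType) (f : 'I_m.+3.-1 -> G) (i k : 'I_m.+3.-1)
    (ik : (i, k).1 < (i, k).2) :
  weval f (@braid_relator m.+3 (exist _ (i, k) ik)) =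
    if k == i.+1 :> nat then f i * f k * f i * (f k)^-1 * (f i)^-1 * (f k)^-1
    else f i * f k * (f i)^-1 * (f k)^-1.
Proof.
rewrite /braid_relator /=; case: ifP => _.
  by rewrite /weval !big_cons big_nil /= mulg1 !mulgA.
by rewrite /weval !big_cons big_nil /= mulg1 !mulgA.
Qed.

Lemma sigma_relator (i k : 'I_m.+3.-1) (ik : (i, k).1 < (i, k).2) :
  weval (@sigma m.+3) (@braid_relator m.+3 (exist _ (i, k) ik)) = 1.
Proof.
by rewrite [LHS](@weval_pgen (braid_presentation m.+3)); apply: pclass_relator.
Qed.

Lemma sg_braid k : k.+1 < m.+2 ->
  sg k * sg k.+1 * sg k = sg k.+1 * sg k * sg k.+1.
Proof.
move=> kn; pose i : 'I_m.+3.-1 := inord k; pose l : 'I_m.+3.-1 := inord k.+1.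
have iE : i = k :> nat by rewrite inordK // ltnW.
have lE : l = k.+1 :> nat by rewrite inordK.
have il : (i, l).1 < (i, l).2 by rewrite /= iE lE.
have := sigma_relator il; rewrite braid_relatorE iE lE eqxx.
by move/divg1_eq/eqP; rewrite !divg_eq => /eqP.
Qed.

Lemma sg_comm i k : i.+1 < k -> k < m.+2 -> sg i * sg k = sg k * sg i.
Proof.
move=> ik kn; pose x : 'I_m.+3.-1 := inord i; pose y : 'I_m.+3.-1 := inord k.
have xE : x = i :> nat by rewrite inordK // (ltn_trans _ kn) // ltnW.
have yE : y = k :> nat by rewrite inordK.
have xy : (x, y).1 < (x, y).2 by rewrite /= xE yE ltnW.
have := sigma_relator xy; rewrite braid_relatorE xE yE gtn_eqF //.
by move/divg1_eq/eqP; rewrite divg_eq => /eqP.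
Qed.

Lemma sg_conjS k : k.+1 < m.+2 ->
  sg k * sg k.+1 * sg k * (sg k * sg k.+1)^-1 = sg k.+1.
Proof. by move=> kn; rewrite sg_braid // -(mulgA (sg k.+1)) mulgK. Qed.

End BraidRelations.

Definition comm (G : groupType) (x y : G) := x * y * x^-1 * y^-1.

Lemma commV (G : groupType) (x y : G) : (comm x y)^-1 = comm y x.
Proof. by rewrite /comm !invgM !invgK !mulgA. Qed.

Section BraidXmod.
Variables (m : nat) (D : xmod (braid_group m.+3)) (r : D).
Local Notation B := (braid_group m.+3).
Local Notation sg := (sg m).

(** The image is normal and all Artin generators are conjugate: go down from [j] to 0, then up to
    any index. *)
Lemma braid_image_full (j : 'I_m.+3.-1) : bd D r = sigma j ->
  forall x, in_image (P := braid_presentation m.+3) r x.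
Proof.
move=> rj; set I := in_image _.
have IS k : k.+1 < m.+2 -> I (sg k) <-> I (sg k.+1).
  move=> kn; rewrite -(sg_conjS kn); split; first exact: in_imageJ.
  move/(in_imageJ ((sg k * sg k.+1)^-1)).
  by rewrite invgK [_^-1 * _]mulgA mulKg mulgVK.
have Ij : I (sg j) by exists r; [apply: generated_gen | rewrite sg_ord].
have I0 : I (sg 0).
  elim: (val j) (ltn_ord j) Ij => //= k IHk kn /(IS _ kn); apply: IHk.
  exact: ltnW.
apply: in_image_gen => i; rewrite -[pgen i]/(sigma i) -sg_ord.
elim: (val i) (ltn_ord i) => //= k IHk kn.
by apply/(IS _ kn)/IHk/ltnW.
Qed.

Lemma bd_comm (c d : D) : bd D (comm c d) = comm (bd D c) (bd D d).
Proof. by rewrite /comm !gmulfM !gmulfV. Qed.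

Lemma comm_kernel (c d : D) :
  bd D c * bd D d = bd D d * bd D c -> kernel (comm c d).
Proof. by move=> cd; rewrite /kernel bd_comm /comm cd mulgK mulgV. Qed.

Lemma comm_kerneMl (z c d : D) : kernel z -> comm (z * c) d = comm c d.
Proof.
move=> zK; rewrite /comm invgM -!mulgA (kernel_central _ zK) -!mulgA.
by rewrite -(kernel_central d^-1 zK) mulKg !mulgA.
Qed.

Lemma comm_bdl (c c' d : D) : bd D c = bd D c' -> comm c d = comm c' d.
Proof.
move=> cc'; rewrite -(mulgVK c' c) comm_kerneMl //.
by rewrite /kernel gmulfM gmulfV cc' mulgV.
Qed.

(** Lifts of the same element differ by a central factor, which a commutator does not see. *)
Lemma comm_bd (c c' d d' : D) :
  bd D c = bd D c' -> bd D d = bd D d' -> comm c d = comm c' d'.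
Proof.
by move=> cc' dd'; rewrite (comm_bdl d cc') -commV (comm_bdl c' dd') commV.
Qed.

Hypothesis r0 : bd D r = sg 0.

Lemma braid_image_full0 : forall x, in_image (P := braid_presentation m.+3) r x.
Proof. exact: braid_image_full r0. Qed.

(** The commutator of [c] and [d] lies in the kernel, so [x] fixes it; but [x] carries the
    boundaries of [c] and [d] to those of [c'] and [d']. *)
Lemma comm_conj (x : B) (c d c' d' : D) :
    bd D c * bd D d = bd D d * bd D c ->
    x * bd D c = bd D c' * x -> x * bd D d = bd D d' * x ->
  comm c' d' = comm c d.
Proof.
move=> cd cc' dd'; rewrite -[RHS](act_kernel braid_image_full0 x); last first.
  exact: comm_kernel.
rewrite /comm !act_mulg !act_invg; apply: comm_bd.
  by rewrite bd_act cc' mulgK.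
by rewrite bd_act dd' mulgK.
Qed.

Fixpoint braid_lift (k : nat) : D :=
  if k is k'.+1 then act (sg k' * sg k) (braid_lift k') else r.
Local Notation R := braid_lift.

Lemma bd_braid_lift k : k < m.+2 -> bd D (R k) = sg k.
Proof.
elim: k => [//|k IHk] kn; rewrite /= bd_act IHk; last exact: ltnW.
exact: sg_conjS.
Qed.

(** By Peiffer, conjugation by [R k * R k.+1] is the action of [sg k * sg k.+1], which sends [R k]
    to [R k.+1] by definition. *)
Lemma braid_lift_braid k : k.+1 < m.+2 ->
  R k * R k.+1 * R k = R k.+1 * R k * R k.+1.
Proof.
move=> kn; rewrite -[in RHS]mulgA; apply/eqP; rewrite -divg_eq; apply/eqP.
by rewrite peiffer gmulfM !bd_braid_lift // ltnW.
Qed.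

(** Conjugation by [sg k * sg k.+1] fixes [sg i] and moves [sg k] to [sg k.+1]. *)
Lemma comm_braid_liftS i k : i.+1 < k -> k.+1 < m.+2 ->
  comm (R i) (R k.+1) = comm (R i) (R k).
Proof.
move=> ik kn; have im : i < m.+2 by rewrite (ltn_trans _ kn) // ltnW // ltnW.
have ck : sg i * sg k = sg k * sg i by apply: sg_comm => //; apply: ltnW.
have ck1 : sg i * sg k.+1 = sg k.+1 * sg i by apply: sg_comm => //; apply: ltnW.
apply: (comm_conj (x := sg k * sg k.+1)); rewrite !bd_braid_lift ?(ltnW kn) //.
- by rewrite -mulgA -ck1 !mulgA ck.
- by rewrite mulgA -[RHS]sg_braid.
Qed.

Lemma comm_braid_lift i k : i.+1 < k -> k < m.+2 ->
  comm (R i) (R k) = comm (R 0) (R 2).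
Proof.
(* First the right index is lowered to distance 2; then both indices slide down to 0 and 2. *)
have shrink j l : j.+1 < l -> l < m.+2 ->
    comm (R j) (R l) = comm (R j) (R j.+2).
  elim: l => // l IHl; rewrite ltnS leq_eqVlt => /orP[/eqP <- //|jl] ln.
  by rewrite comm_braid_liftS // IHl // ltnW.
move=> ik kn; rewrite shrink //.
have {ik kn} : i.+2 < m.+2 by apply: leq_ltn_trans kn.
(* The pairs [(i, i.+2)] and [(i.+1, i.+3)] are compared through [(i, i.+3)]: [sg i * sg i.+1]
   conjugates [sg i] to [sg i.+1] and fixes [sg i.+3]. *)
elim: i => // i IHi im; rewrite -IHi 1?ltnW // -(@shrink i i.+3) //.
have i1m : i.+1 < m.+2 by rewrite (ltn_trans _ im).
have c03 : sg i * sg i.+3 = sg i.+3 * sg i by apply: sg_comm.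
have c13 : sg i.+1 * sg i.+3 = sg i.+3 * sg i.+1 by apply: sg_comm.
apply: (comm_conj (x := sg i * sg i.+1)); rewrite !bd_braid_lift ?(ltnW i1m) //.
- by rewrite mulgA -[RHS]sg_braid.
- by rewrite -mulgA c13 !mulgA c03.
Qed.

Lemma comm_braid_lift_sym : 0 < m -> comm (R 2) (R 0) = comm (R 0) (R 2).
Proof.
move=> m_gt0.
have c02 : sg 0 * sg 2 = sg 2 * sg 0 by apply: sg_comm.
have b01 : sg 0 * sg 1 * sg 0 = sg 1 * sg 0 * sg 1 by apply: sg_braid.
have b12 : sg 1 * sg 2 * sg 1 = sg 2 * sg 1 * sg 2 by apply: sg_braid.
(* This braid moves the first two strings past the next two, so conjugation by it exchanges sigma_1
   and sigma_3. *)
apply: (comm_conj (x := sg 1 * sg 0 * sg 2 * sg 1)); rewrite !bd_braid_lift //.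
- rewrite -[LHS]mulgA -(mulgA (sg 1)) c02 (mulgA (sg 1)) -(mulgA _ (sg 0)).
  rewrite (mulgA (sg 0)) b01 !mulgA b12 -!mulgA.
  by rewrite (mulgA (sg 2) (sg 0)) -c02 -!mulgA.
- by rewrite -!mulgA (mulgA (sg 2) (sg 1)) -b12 !mulgA -b01.
Qed.

(** For [0 < m], [sg 2] is sigma_3 and this is the distinguished kernel element; by Peiffer it is a
    commutator of lifts. *)
Definition braid_comm : D := act (sg 2) r * r^-1.

Lemma braid_commE : 0 < m -> braid_comm = comm (R 2) (R 0).
Proof. by move=> m_gt0; rewrite /comm peiffer bd_braid_lift. Qed.

Lemma braid_comm_kernel : 0 < m -> kernel braid_comm.
Proof.
move=> m_gt0; rewrite braid_commE //; apply: comm_kernel.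
by rewrite !bd_braid_lift //; apply/esym/sg_comm.
Qed.

Lemma braid_commV : 0 < m -> braid_comm^-1 = braid_comm.
Proof. by move=> m_gt0; rewrite braid_commE // commV -comm_braid_lift_sym. Qed.

(** The condition [0 < m] makes this trivial on three strings, where no two generators are distant,
    so that all cases are treated at once. *)
Definition braid_kernel_pred (c : D) : Prop := c = 1 \/ 0 < m /\ c = braid_comm.

Lemma braid_kernel_pred_normal : normal_pred braid_kernel_pred.
Proof.
have aa : 0 < m -> braid_comm * braid_comm = 1.
  by move=> m_gt0; rewrite -{2}braid_commV // mulgV.
split=> [|x y|x|x y]; first by left.
- by move=> [->|[m_gt0 ->]] [->|[? ->]]; rewrite ?mul1g ?mulg1 ?aa //;
    [left | right..| left].
- by move=> [->|[m_gt0 ->]]; rewrite ?invg1 ?braid_commV //; [left | right].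
move=> [->|[m_gt0 ->]]; first by rewrite mulg1 mulgV; left.
by rewrite -(kernel_central x (braid_comm_kernel m_gt0)) mulgK; right.
Qed.

Let f (i : 'I_m.+3.-1) : D := R i.

Lemma braid_relator_lift (c : braid_rel m.+3) :
  braid_kernel_pred (weval f (braid_relator c)).
Proof.
case: c => [[i k] ik]; rewrite braid_relatorE /f; case: eqP => [kE|/eqP ki].
  left; have ki : i.+1 < m.+2 by rewrite -kE.
  by rewrite kE braid_lift_braid // !mulgK mulgV.
have {}ik : i.+1 < k by rewrite ltn_neqAle eq_sym ki.
have m_gt0 : 0 < m.
  exact: leq_ltn_trans (leq_trans (isT : 2 <= i.+2) ik) (ltn_ord k).
right; split=> //; rewrite -/(comm _ _) comm_braid_lift //.
by rewrite braid_commE // comm_braid_lift_sym.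
Qed.

(** By Peiffer, a word acts on [r] as conjugation by the corresponding word in the lifts, and [r] is
    itself the lift of index 0. *)
Lemma generated_braid_lift c :
  generated_by (P := braid_presentation m.+3) r c -> exists w, c = weval f w.
Proof.
pose W c := exists w, c = weval f w.
have WM x y : W x -> W y -> W (x * y).
  by move=> [u ->] [v ->]; exists (u ++ v); rewrite [RHS]big_cat.
have WV x : W x -> W x^-1.
  move=> [u ->]; exists (@inv_word (braid_presentation m.+3) u).
  by rewrite (@weval_inv (braid_presentation m.+3)).
have bdf w : bd D (weval f w) = pclass (P := braid_presentation m.+3) w.
  rewrite ghom_weval -weval_pgen; apply: eq_bigr => -[i e] _ /=.
  by rewrite /f bd_braid_lift ?sg_ord.
have Wr : W r.
  by exists [:: (inord 0, true)]; rewrite /weval big_seq1 /= /f inordK.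
case=> s ->; elim: s => [|q s IHs].
  by exists [::]; rewrite /conj_prod /weval !big_nil.
rewrite /conj_prod big_cons; apply: (WM) IHs.
rewrite weval_pgen -bdf -peiffer; apply: (WM); last by apply: (WV); exists q.1.
by apply: (WM); [exists q.1 | case: q.2; rewrite //=; apply: (WV)].
Qed.

(** Such an element is a word in the lifts that is trivial in the braid group, hence trivial modulo
    the values of the relators on the lifts. *)
Lemma braid_kernel c : generated_by (P := braid_presentation m.+3) r c ->
  kernel c -> braid_kernel_pred c.
Proof.
move=> /generated_braid_lift[w ->]; rewrite /kernel ghom_weval => w1.
have := @word_eq_mod (braid_presentation m.+3) _ f _ w [::]
  braid_kernel_pred_normal braid_relator_lift.
rewrite weval_nil invg1 mulg1; apply; apply/pclassP.
rewrite -[RHS]w1 -weval_pgen; apply: eq_bigr => -[i e] _ /=.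
by rewrite /f bd_braid_lift ?sg_ord.
Qed.

End BraidXmod.

(** * Nontriviality of the commutator *)

Section Clifford.
Local Open Scope ring_scope.

(** Doubling: the old generators become [diag(g i, - g i)], and the new one is the block swap, which
    anticommutes with them. *)
Lemma clifford_matrices (F : nzRingType) (n : nat) :
  exists (d : nat) (g : nat -> 'M[F]_d.+1),
    (forall i, (i < n)%N -> g i * g i = 1)
    /\ (forall i k, (i < n)%N -> (k < n)%N -> i != k ->
        g i * g k = - (g k * g i)).
Proof.
elim: n => [|n [d [g [g2 gC]]]]; first by exists 0%N, (fun => 1).
pose h i : 'M[F]_(d.+1 + d.+1) :=
  if (i < n)%N then block_mx (g i) 0 0 (- g i) else block_mx 0 1 1 0.
(* The size [d.+1 + d.+1] is the successor of [d + d.+1]. *)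
exists (d + d.+1)%N, h; split=> [i|i k]; rewrite !ltnS.
  move=> _; rewrite -[LHS]/(h i *m h i) /h.
  case: ltnP => [ilt|_]; rewrite mulmx_block ?mulmx0 ?mul0mx ?addr0 ?add0r.
    by rewrite mulmxN mulNmx opprK [_ *m _]g2 // -scalar_mx_block.
  by rewrite mulmx1 -scalar_mx_block.
move=> ile kle ik; rewrite -[LHS]/(h i *m h k).
rewrite -[RHS]/(- (h k *m h i : 'M[F]_(d.+1 + d.+1))) /h.
case: (ltnP i n) => [ilt|ige]; case: (ltnP k n) => [klt|kge].
- rewrite !mulmx_block ?mulmx0 ?mul0mx ?addr0 ?add0r opp_block_mx !oppr0.
  by rewrite !mulmxN !mulNmx !opprK [g i *m g k](gC i k ilt klt ik).
- rewrite !mulmx_block ?mulmx0 ?mul0mx ?addr0 ?add0r opp_block_mx !oppr0.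
  by rewrite !mulmx1 !mul1mx opprK.
- rewrite !mulmx_block ?mulmx0 ?mul0mx ?addr0 ?add0r opp_block_mx !oppr0.
  by rewrite !mulmx1 !mul1mx opprK.
- by rewrite eqn_leq (leq_trans ile kge) (leq_trans kle ige) in ik.
Qed.

End Clifford.

Section Anticommuting.
Local Open Scope ring_scope.
Variable R : nzRingType.
Hypothesis two : 1 + 1 = - 1 :> R.
Implicit Types a b c d : R.

(** The cross terms cancel and leave 2, which is -1 in characteristic 3; thus differences are
    invertible without dividing by a square root of 2. *)
Lemma anti_sqr a b : a * a = 1 -> b * b = 1 -> a * b = - (b * a) ->
  (a - b) * (a - b) = - 1.
Proof.
move=> aa bb ab; rewrite mulrBl !mulrBr aa bb ab opprK opprB addrACA -two.
by rewrite subrr addr0.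
Qed.

(** For [u = a - b] and [v = b - c] one has [u v + v u = 1] and [u u = v v = -1], so both sides
    equal [u + v]. *)
Lemma anti_braid a b c : a * a = 1 -> b * b = 1 -> c * c = 1 ->
    a * b = - (b * a) -> a * c = - (c * a) -> b * c = - (c * b) ->
  (a - b) * (b - c) * (a - b) = (b - c) * (a - b) * (b - c).
Proof.
move=> aa bb cc ab ac bc.
have uv : (a - b) * (b - c) = 1 - (b - c) * (a - b).
  rewrite !mulrBl !mulrBr bb ab ac bc !opprB !opprK -two !addrA.
  by rewrite [RHS](ACl (5*2*3*1*4)).
move: (a - b) (b - c) (anti_sqr aa bb ab) (anti_sqr bb cc bc) uv.
move=> u v uu vv uv.
rewrite -[RHS]mulrA uv mulrBl mulrBr -[(v * u * u)%R]mulrA uu mulrA vv.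
by rewrite mulN1r mulrN1 mul1r mulr1 !opprK addrC.
Qed.

Lemma anti_comm a b c d :
    a * c = - (c * a) -> a * d = - (d * a) ->
    b * c = - (c * b) -> b * d = - (d * b) ->
  (a - b) * (c - d) = - ((c - d) * (a - b)).
Proof.
move=> ac ad bc bd; rewrite !mulrBl !mulrBr ac ad bc bd !opprB !opprK.
by rewrite !addrA [RHS](ACl (4*1*2*3)).
Qed.

Lemma anticommuting_diff (m : nat) (g : nat -> R) :
    (forall i, (i < m.+3)%N -> g i * g i = 1) ->
    (forall i k, (i < m.+3)%N -> (k < m.+3)%N -> i != k ->
      g i * g k = - (g k * g i)) ->
  let t i := g i - g i.+1 in
  [/\ forall i, (i < m.+2)%N -> t i * t i = - 1,
      forall i, (i.+1 < m.+2)%N -> t i * t i.+1 * t i = t i.+1 * t i * t i.+1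
    & forall i k, (i.+1 < k)%N -> (k < m.+2)%N -> t i * t k = - (t k * t i)].
Proof.
move=> g2 gC.
have gN j l : (j < l)%N -> (l < m.+3)%N -> g j * g l = - (g l * g j).
  by move=> jl lm; apply: gC => //; [apply: ltn_trans lm | rewrite ltn_eqF].
split=> [i im|i im|i k ik km].
- by apply: anti_sqr; [apply/g2/ltnW | apply: g2 | apply: gN].
- have im2 : (i < m.+3)%N by apply/ltnW/ltnW.
  by apply: anti_braid; [apply: g2 | apply/g2/ltnW | apply: g2
    | apply/gN/ltnW | apply: gN | apply: gN].
by apply: anti_comm; apply: gN; rewrite // ltnW // ltnW.
Qed.

End Anticommuting.

Section SpinCover.
Variable m : nat.

Lemma spin_matrices (F : nzRingType) : (1 + 1 = - 1 :> F)%R ->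
  exists (d : nat) (t : nat -> 'M[F]_d.+1),
  [/\ forall i, i < m.+2 -> (t i * t i = - 1)%R,
      forall i, i.+1 < m.+2 ->
        (t i * t i.+1 * t i = t i.+1 * t i * t i.+1)%R
    & forall i k, i.+1 < k -> k < m.+2 -> (t i * t k = - (t k * t i))%R].
Proof.
move=> twoF; have [d [g [g2 gC]]] := clifford_matrices F m.+3.
have two : (1 + 1 = - 1 :> 'M[F]_d.+1)%R.
  by rewrite -[1%R]/(1%:M)%R -raddfD -raddfN twoF.
by exists d, (fun i => g i - g i.+1)%R; apply: anticommuting_diff.
Qed.

Lemma spin_group : exists (H : groupType) (z : H) (t : nat -> H),
  [/\ z * z = 1, z != 1, forall x, z * x = x * z,
      forall i, i.+1 < m.+2 -> t i * t i.+1 * t i = t i.+1 * t i * t i.+1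
    & forall i k, i.+1 < k -> k < m.+2 -> t i * t k = z * (t k * t i)].
Proof.
have two : (1 + 1 = - 1 :> 'F_3)%R by apply/val_inj.
have [d [t [t2 tB tC]]] := spin_matrices two.
set R := 'M['F_3]_d.+1 in t t2 tB tC.
have zU : (- 1 : R)%R \is a GRing.unit by rewrite unitrN unitr1.
(* In range the inverse is [- t i]; out of range nothing is known about [t i], so 1 replaces it. *)
have tU i : (if i < m.+2 then t i else 1%R) \is a GRing.unit.
  case: ifP => [/t2 ti|_]; last exact: unitr1.
  by apply/unitrP; exists (- t i)%R; rewrite mulNr mulrN ti opprK.
pose z : {unit R} := FinRing.unit R zU.
pose tt i : {unit R} := FinRing.unit R (tU i).
have valt i : i < m.+2 -> val (tt i) = t i by rewrite /tt /= => ->.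
exists {unit R}, z, tt; split.
- by apply: val_inj; rewrite /= mulrNN mulr1.
- apply/eqP => /(congr1 val) /= /eqP; rewrite eq_sym -addr_eq0.
  rewrite -[1%R]/(1%:M)%R -raddfD two => /eqP/matrixP/(_ ord0 ord0)/eqP.
  by rewrite !mxE.
- by move=> x; apply: val_inj; rewrite /= mulN1r mulrN1.
- move=> i im; apply: val_inj; rewrite !FinRing.val_unitM !valt ?tB //.
  by apply: ltnW.
move=> i k ik km; apply: val_inj; rewrite !FinRing.val_unitM !valt //.
  by rewrite tC // mulN1r.
by apply: ltn_trans km; apply: ltnW.
Qed.

(* In the extension of [B] by the bar complex, the commutator of the lifts of
   two distant generators survives in any group where they anticommute. *)
Lemma bar_braid_comm_neq1 : 0 < m ->
  braid_comm (bar_lift (sg m 0) : bar_xmod (braid_group m.+3)) <> 1.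
Proof.
move=> m_gt0; have [H [z [t [zz z1 zC tB tC]]]] := spin_group.
pose K x := x = 1 \/ x = z.
have zV : z^-1 = z by apply: mulg1_eq.
have KP : central_pred K.
  split; first by left.
  - by move=> x y [->|->] [->|->]; rewrite ?mul1g ?mulg1 ?zz;
      [left | right | right | left].
  - by move=> x [->|->]; rewrite ?invg1 ?zV; [left | right].
  - by move=> x y [->|->]; rewrite ?mul1g ?mulg1.
have [K1 KM KV KC] := KP.
have KN : normal_pred K.
  by split=> // x y Ky; rewrite -(KC _ x Ky) mulgK.
pose P := braid_presentation m.+3; pose f (i : gen P) := t i.
have frel (c : rel_index P) : K (weval f (relator c)).
  case: c => [[i k] ik]; rewrite [weval _ _]braid_relatorE /f.
  case: eqP => [kE|/eqP ki].
    left; rewrite kE tB ?mulgK ?mulgV // -kE; exact: ltn_ord.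
  right; rewrite tC ?ltn_ord //; last by rewrite ltn_neqAle eq_sym ki.
  by rewrite mulgA !mulgK.
(* Words for the same element have values that agree modulo [K], so the defects of this section lie
   in [K]. *)
pose s (x : pgroup P) := weval f (repr x).
have sw u x : pclass u = x -> K (weval f u * (s x)^-1).
  move=> ux; apply: word_eq_mod => //; apply/pclassP.
  by rewrite pclassK.
have Ks x y : K (s x * s y * (s (x * y))^-1).
  by rewrite -weval_cat; apply: sw; rewrite pclass_cat !pclassK.
have [psi [psis _]] := bar_ext_lift KP Ks.
have sgK k : k < m.+2 -> K (t k * (s (sg m k))^-1).
  move=> km; have := sw [:: (inord k, true)] (sg m k) erefl.
  by rewrite weval_cons weval_nil mulg1 /= /f inordK.
move=> /(congr1 psi); rewrite gmulf1 gmulfM gmulfV.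
rewrite [act _ _]/(bar_lift _ * _ * (bar_lift _)^-1) !gmulfM gmulfV !psis.
(* [s20] says that the values of [s] at [sg 2] and [sg 0] commute. They agree with [t 2] and [t 0]
   up to central factors, so these commute too, forcing [z = 1]. *)
move/divg1_eq/eqP; rewrite divg_eq => /eqP s20; apply/(elimN eqP z1).
have tsC k : k < m.+2 -> exists2 y, K y & t k = y * s (sg m k).
  by move=> km; exists (t k * (s (sg m k))^-1); [apply: sgK | rewrite mulgVK].
have [y0 Ky0 t0] := tsC 0 isT; have [y2 Ky2 t2] := tsC 2 m_gt0.
have t02 : t 0 * t 2 = t 2 * t 0.
  rewrite t0 t2 -[LHS]mulgA -[RHS]mulgA (mulgA (s _)) -(KC y2 (s (sg m 0))) //.
  rewrite (mulgA (s (sg m 2))) -(KC y0 (s (sg m 2))) // -!mulgA s20 !mulgA.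
  by rewrite (KC y0).
by apply: (mulIg (t 2 * t 0)); rewrite -tC // t02 mul1g.
Qed.

End SpinCover.

(** The defects of a section of [bd] lie in the kernel, which is central; compatibility with the
    actions is Peiffer in [D]. *)
Lemma bar_xmod_lift (G : groupType) (D : xmod G) (s : G -> D) :
    (forall x, bd D (s x) = x) ->
  exists2 psi : {ghom bar_xmod G -> D},
    xmod_morphism (C := bar_xmod G) (D := D) psi idfun
    & forall x, psi (bar_lift x) = s x.
Proof.
move=> sK.
have KP : central_pred (@kernel G D).
  have [K1 KM KV] := kernel_subgroup D.
  by split=> // x y Kx; apply: kernel_central.
have Ks x y : kernel (s x * s y * (s (x * y))^-1).
  by rewrite /kernel !gmulfM gmulfV !sK mulgV.
have [psi [psis psiK]] := bar_ext_lift KP Ks.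
exists psi => //; split=> [e|x e].
  rewrite [e in LHS](ext_decomp (e : bar_ext G)) gmulfM psis gmulfM sK.
  by rewrite psiK mul1g.
by rewrite /= -[x in RHS]sK -peiffer -!psis -gmulfV -!gmulfM.
Qed.

Section TrivialExtension.
Variables (G : groupType) (M : zmodType).

Definition trivial_cocycle (x y : G) : M := 0%R.

Lemma trivial_cocycleP : cocycle trivial_cocycle.
Proof. by move=> x y z; rewrite /trivial_cocycle !subr0 addr0. Qed.

End TrivialExtension.
Arguments trivial_cocycleP : clear implicits.

Notation triv_incl m := (ext_incl (trivial_cocycleP _ _) m).

(** * Mapping the free crossed module to the bar extension *)

Section FreeBraidXmod.
Variables (m : nat) (j : 'I_m.+3.-1).
Local Notation B := (braid_group m.+3).
Local Notation P := (braid_presentation m.+3).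

(** Every braid relator has exponent sum zero, so all generators may be sent to the same element. *)
Lemma braid_constant (H : groupType) (k : H) :
  exists2 theta : {ghom B -> H}, (forall i, theta (sigma i) = k)
    & forall w, theta (pclass (P := P) w) = weval (fun=> k) w.
Proof.
have [|theta thetaE] := @pgroup_lift P H (fun=> k).
  case=> [[i l] il]; rewrite [LHS]braid_relatorE.
  by case: ifP => _; rewrite !mulgK ?mulgV.
by exists theta => // i; rewrite thetaE weval_cons weval_nil mulg1.
Qed.

Variables (C : xmod B) (r : C).
Hypotheses (Cfree : xmod_free (fun _ : unit => r)) (rj : bd C r = sigma j).

(** The discrepancy of the two maps at [r] is a kernel element; sending every Artin generator to it
    gives the [theta] of [free_kernel_eq]. *)
Lemma braid_free_kernel_eq (D : xmod B) (b1 b2 : {ghom C -> D}) :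
    xmod_morphism (C := C) (D := D) b1 idfun ->
    xmod_morphism (C := C) (D := D) b2 idfun ->
  forall c, kernel c -> b1 c = b2 c.
Proof.
move=> b1P b2P; pose k : D := (b2 r)^-1 * b1 r.
have k_ker : kernel k.
  by rewrite /kernel /k gmulfM gmulfV b1P.1 b2P.1 mulVg.
have [theta theta_sg thetaE] := braid_constant k.
apply: (@free_kernel_eq P C D r b1 b2 theta) => //.
- by apply: (@braid_image_full _ _ _ j); rewrite b2P.1.
- by rewrite rj theta_sg.
move=> x; rewrite -(pclassK (P := P) x) thetaE /kernel ghom_weval.
elim: (repr x) => [|[i e] u IHu]; first exact: (@weval_nil P).
rewrite (@weval_cons P) IHu mulg1 /= k_ker.
by case: e => //=; rewrite invg1.
Qed.

Lemma bar_full :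
  forall x, in_image (P := P) (bar_lift (sigma j) : bar_xmod B) x.
Proof. exact: (@braid_image_full _ _ _ j). Qed.

Lemma free_to_bar : exists2 beta : {ghom C -> bar_xmod B},
  xmod_morphism (C := C) (D := bar_xmod B) beta idfun
  & beta r = bar_lift (sigma j).
Proof.
have [|beta [betar betaP] _] := Cfree (D := bar_xmod B)
  (alpha := (idfun : {ghom B -> B})) (b := fun=> bar_lift (sigma j)).
  by move=> _; rewrite rj.
by exists beta => //; apply: (betar tt).
Qed.

Variable beta : {ghom C -> bar_xmod B}.
Hypotheses (betaP : xmod_morphism (C := C) (D := bar_xmod B) beta idfun)
  (betar : beta r = bar_lift (sigma j)).

Lemma free_to_bar_inj : injective beta.
Proof.
apply: gmulf_inj => c c1.
have cK : kernel c by rewrite /kernel -[LHS]betaP.1 c1 gmulf1.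
have /choice[s sK] : forall x, exists d, bd C d = x.
  by move=> x; have [d _ <-] := braid_image_full rj x; exists d.
have [psi psiP _] := bar_xmod_lift sK.
pose b1 : {ghom C -> C} := [the {ghom C -> C} of psi \o beta].
rewrite -[c]/((idfun : {ghom C -> C}) c) -(@braid_free_kernel_eq _ b1 idfun) //.
  by rewrite /b1 /= c1 gmulf1.
split=> [d|x d] /=; first by rewrite psiP.1 /= betaP.1.
by rewrite betaP.2 /= psiP.2.
Qed.

Lemma free_to_bar_cycle c : kernel c ->
  exists2 b, bar_d2 B b = 0%R & beta c = bar_incl (bar_pi B b).
Proof.
move=> cK; pose D := ext_xmod (trivial_cocycleP B (bar1 B)).
(* The target is the direct product of [bar1 B] and [B]; the defect of this section at [(x, y)] is
   [d2 [x|y]], so [psi] restricts to [d2] on chains. *)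
pose s (x : B) : D := ((<< x >>%R, x) : ext (trivial_cocycleP B (bar1 B))).
have sK x : bd D (s x) = x by [].
have [psi psiP psis] := bar_xmod_lift sK.
have psiE b : psi (bar_incl (bar_pi B b)) = triv_incl (bar_d2 B b).
  elim/freeg_ind: b => [|a b IHa IHb|a IHa|[x y]].
  - by rewrite !raddf0 ext_incl0 gmulf1 ext_incl0.
  - by rewrite !raddfD !ext_inclD gmulfM IHa IHb.
  - by rewrite !raddfN !ext_inclN gmulfV IHa.
  have : psi (bar_incl (bar_pi B << (x, y) >>%R)) * psi (bar_lift (x * y))
      = psi (bar_lift x) * psi (bar_lift y).
    by rewrite -!gmulfM; congr (psi _); rewrite (ext_liftM (bar_cocycleP B)).
  rewrite !psis => psixy; apply: (mulIg (s (x * y))); rewrite psixy.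
  rewrite [LHS]ext_prodE [RHS]ext_incl_mull bar_d2U /=.
  by rewrite /trivial_cocycle addr0 addrAC subrK addrC.
have [b1 b1E] : exists b1 : {ghom C -> D}, b1 =1 psi \o beta.
  by exists [the {ghom C -> D} of psi \o beta].
(* The comparison map goes through [bd] and [x |-> (0, x)]; it is trivial on the kernel, so
   [psi \o beta] is too. *)
have liftM : {morph (ext_lift (trivial_cocycleP B (bar1 B))) : x y / x * y}.
  by move=> x y; rewrite ext_liftM ext_incl0 mul1g.
have [b2 b2E] : exists b2 : {ghom C -> D},
    forall c, b2 c = mk_ghom liftM (bd C c).
  by exists [the {ghom C -> D} of mk_ghom liftM \o bd C].
have : b1 c = b2 c.
  apply: braid_free_kernel_eq cK.
    split=> [d|x d] /=; rewrite !b1E /=; first by rewrite psiP.1 /= betaP.1.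
    by rewrite betaP.2 /= psiP.2.
  split=> [d|x d]; rewrite !b2E //.
  by rewrite bd_act !gmulfM gmulfV.
rewrite b1E b2E cK gmulf1 /=.
have [mm cm] : exists mm, beta c = bar_incl mm.
  by apply: ext_inclP; rewrite -[LHS]/(bd (bar_xmod B) (beta c)) betaP.1.
rewrite cm; have -> : mm = bar_pi B (repr mm) by rewrite /bar_pi /= reprK.
rewrite psiE -(ext_incl0 (trivial_cocycleP B (bar1 B))) => /ext_incl_inj b0.
by exists (repr mm).
Qed.

Lemma free_to_bar_generated d :
  generated_by (P := P) (bar_lift (sigma j) : bar_xmod B) d ->
  exists2 c, generated_by (P := P) r c & beta c = d.
Proof.
have betae e : beta (signed r e) = signed (bar_lift (sigma j) : bar_xmod B) e.
  by case: e => /=; rewrite ?gmulfV betar.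
case=> s ->; exists (conj_prod (P := P) r s); first by exists s.
rewrite /conj_prod gmulf_prod; apply: eq_bigr => q _.
by rewrite betaP.2 betae.
Qed.

End FreeBraidXmod.

(** * The canonical isomorphism *)

Section SecondHomology.
Local Open Scope ring_scope.
Variable G : groupType.

Definition H2_bar (h : H2 G) : barq G := bar_pi G (val (repr h)).

Lemma H2_classE (h : H2 G) b : homology_class h b -> H2_bar h = bar_pi G b.
Proof.
case=> z <- ->; apply/bar_piP.
have : repr (\pi_(homology (bar_d3 G) (bar_d2 G)) z)%qT
    = z %[mod homology (bar_d3 G) (bar_d2 G)]%qT by rewrite reprK.
move/eqP; rewrite -Quotient.idealrBE inE => /asboolP[c cE].
by exists c; rewrite [LHS]cE raddfB.
Qed.

Lemma H2_cycle (h : H2 G) : bar_d2 G (val (repr h)) = 0.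
Proof. by have := cycleP (repr h); rewrite inE => /eqP. Qed.

Lemma H2_class_ex b : bar_d2 G b = 0 -> exists h : H2 G, homology_class h b.
Proof.
move=> b0; have bZ : b \in is_cycle (bar_d2 G) by rewrite inE b0.
by exists (\pi_(homology (bar_d3 G) (bar_d2 G)) (Cycle bZ))%qT,
  (Cycle bZ).
Qed.

Lemma H2_bar_inj : injective H2_bar.
Proof.
move=> h h' /bar_piP[c cE]; rewrite -[h]reprK -[h']reprK.
apply/eqP; rewrite -Quotient.idealrBE inE; apply/asboolP; exists c.
by rewrite [LHS]cE raddfB.
Qed.

Lemma H2_barD h h' : H2_bar (h + h') = H2_bar h + H2_bar h'.
Proof.
rewrite -[RHS]raddfD; apply: H2_classE; exists (repr h + repr h') => //.
by rewrite raddfD /= !reprK.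
Qed.

Lemma H2_bar0 : H2_bar 0 = 0.
Proof. by apply: (addrI (H2_bar 0)); rewrite -H2_barD !addr0. Qed.

End SecondHomology.

(** * Identities among relators and their evaluation *)

Section Spherical.
Variables (P : presentation) (w : word (gen P)).
Local Notation A := (attach w).
Local Notation G := (pgroup P).
Implicit Types (Q : spherical w) (z : {freeg (rel_index P) / int}).

Section Evaluation.
Variables (H : groupType) (f : gen P -> H).

Definition sph_eval Q : H :=
  \prod_(q <- Q) let: (u, c, e) := q in
     weval f u * signed (weval f (@relator A c)) e * (weval f u)^-1.

(** An identity holding in the free group can thus be tested in any group, whether or not the
    relators vanish there. *)
Lemma free_eval : exists T : {ghom free_group (gen P) -> H},
  (forall u, T (weval (@free_gen _) u) = weval f u)
  /\ forall Q, T (sph_boundary Q) = sph_eval Q.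
Proof.
have [|T TE] := @pgroup_lift (free_presentation (gen P)) H f; first by case.
have Tu u : T (weval (@free_gen _) u) = weval f u.
  by rewrite [weval _ _](@weval_pgen (free_presentation (gen P))) TE.
exists T; split=> // Q; rewrite /sph_boundary gmulf_prod.
apply: eq_bigr => -[[u c] e] _.
have Ts x : T (signed x e) = signed (T x) e by case: e => //=; rewrite gmulfV.
by rewrite -!Tu -Ts -gmulfV -!gmulfM.
Qed.

End Evaluation.

Definition old_cells Q : bool := all (fun q => q.1.2 != None) Q.

Lemma sph_boundary_cat Q Q' :
  sph_boundary (Q ++ Q') = sph_boundary Q * sph_boundary Q'.
Proof. exact: big_cat. Qed.

(** The quotient [u v^-1] is a product of conjugates of relators of [P]; such entries are invisible
    to [sph_push]. *)
Lemma relators_spherical u v : word_eq u v ->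
  exists2 Q, old_cells Q &
    sph_boundary Q = weval (@free_gen (gen P)) u * (weval (@free_gen _) v)^-1.
Proof.
pose N (g : free_group (gen P)) := exists2 Q, old_cells Q & sph_boundary Q = g.
move=> uv.
apply: (@word_eq_mod P _ (@free_gen (gen P)) N u v _ _ uv); last first.
  move=> c; exists [:: ([::], Some c, true)] => //.
  by rewrite /sph_boundary big_seq1 weval_nil mul1g invg1 mulg1.
split=> [|x y [Q Qo <-] [Q' Qo' <-]|x [Q Qo <-]|x y [Q Qo <-]].
- by exists [::]; rewrite /sph_boundary ?big_nil.
- exists (Q ++ Q'); last exact: sph_boundary_cat.
  by rewrite /old_cells all_cat; apply/andP.
- elim: Q Qo => [_|q Q IHQ /= /andP[qo /IHQ[Q' Qo' Q'E]]].
    by exists [::]; rewrite /sph_boundary ?big_nil ?invg1.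
  exists (Q' ++ [:: (q.1, ~~ q.2)]).
    by rewrite /old_cells all_cat /= andbT qo andbT.
  rewrite sph_boundary_cat Q'E /sph_boundary big_seq1 big_cons invgM.
  congr (_ * _); case: q {qo} => -[u' c] e /=; rewrite !invgM invgK -mulgA.
  by congr (_ * (_ * _)); case: e => /=; rewrite ?invgK.
pose xw : word (gen P) := repr x.
exists [seq (xw ++ q.1.1, q.1.2, q.2) | q <- Q].
  by rewrite /old_cells all_map; apply: sub_all Qo => -[[]].
have xE : x = weval (@free_gen _) xw.
  by rewrite [weval _ _](@weval_pgen (free_presentation (gen P))) pclassK.
rewrite /sph_boundary big_map; elim: Q {Qo} => [|[[u' c] e] Q IHQ].
  by rewrite !big_nil mulg1 mulgV.
rewrite !big_cons IHQ /= [weval _ (_ ++ _)]big_cat /= -/(weval _ xw) -xE.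
by rewrite invgM !mulgA mulgVK.
Qed.

Definition old_part : {additive {freeg (rel_index A) / int} ->
    {freeg (rel_index P) / int}} :=
  freeg_lift (fun c : option (rel_index P) =>
    if c is Some c' then << c' >> else 0)%R.

Lemma old_partK z : old_part (cell_incl w z) = z.
Proof.
move: z; apply: (eq_freeg_additive (f := old_part \o cell_incl w) (g := id)).
- by move=> a b /=; rewrite [cell_incl w _]raddfB raddfB.
- by [].
by move=> x; rewrite /= [cell_incl w _]freeg_liftU [old_part _]freeg_liftU.
Qed.

Lemma old_part_decomp (a : {freeg (rel_index A) / int}) :
  a = (cell_incl w (old_part a) + << coeff None a *g None >>)%R.
Proof.
elim/freeg_ind: a => [|a b IHa IHb|a IHa|[c|]].
- by rewrite !raddf0 [cell_incl w _]raddf0 add0r freegU0.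
- rewrite raddfD [cell_incl w _]raddfD coeffD -freegUD addrACA.
  by rewrite -IHa -IHb.
- by rewrite raddfN [cell_incl w _]raddfN coeffN -freegUN -opprD -IHa.
- rewrite [old_part _]freeg_liftU [cell_incl w _]freeg_liftU.
  by rewrite coeffU mulr0 freegU0 addr0.
by rewrite [old_part _]freeg_liftU [cell_incl w _]raddf0 coeffU mulr1 add0r.
Qed.

End Spherical.

HB.instance Definition _ (P : presentation) :=
  GRing.isZmodMorphism.Build {freeg (rel_index P) / int} (bar2 (pgroup P))
    (@cell_to_bar P) (lift_is_additive _).
HB.instance Definition _ (P : presentation) :=
  GRing.isZmodMorphism.Build {freeg (rel_index P) / int} {freeg (gen P) / int}
    (@cell_d2 P) (lift_is_additive _).
HB.instance Definition _ (P : presentation) (w : word (gen P)) :=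
  GRing.isZmodMorphism.Build {freeg (rel_index P) / int}
    {freeg (rel_index (attach w)) / int} (@cell_incl P w) (lift_is_additive _).

Lemma signed_ext_incl (G : groupType) (M : zmodType) (f : G -> G -> M)
    (fP : cocycle f) m e :
  signed (ext_incl fP m) e = ext_incl fP (if e then m else - m)%R.
Proof. by case: e; rewrite //= ext_inclN. Qed.

Section CanonicalEvaluation.
Variables (P : presentation) (w : word (gen P)).
Local Notation A := (attach w).
Local Notation G := (pgroup P).
Implicit Types (Q : spherical w).

Definition word_ab (v : word (gen P)) : {freeg (gen P) / int} :=
  (\sum_(l <- v) << (if l.2 then 1 else -1) *g l.1 >>)%R.

Lemma freegU_sign (K : choiceType) (e : bool) (x : K) :
  (<< (if e then 1 else -1) *g x >> = (if e then << x >> else - << x >>)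
    :> {freeg K / int})%R.
Proof. by case: e => //; rewrite freegUN. Qed.

Lemma cell_d2_sg (c : rel_index A) (e : bool) :
  (cell_d2 (P := A) << (if e then 1 else -1) *g c >>
    = if e then word_ab (@relator A c) else - word_ab (@relator A c))%R.
Proof. exact: freeg_lift_sg. Qed.

(** Evaluation in the free abelian group on the generators, realized inside a trivial extension,
    makes the conjugators cancel. *)
Lemma sph_boundary_ab Q :
  sph_boundary Q = 1 -> cell_d2 (P := A) (sph_hurewicz Q) = 0%R.
Proof.
pose fP := trivial_cocycleP G {freeg (gen P) / int}.
pose f (x : gen P) : ext fP := ext_incl fP << x >>%R.
have fw v : weval f v = ext_incl fP (word_ab v).
  elim: v => [|[x b] v IHv].
    by rewrite weval_nil /word_ab big_nil ext_incl0.
  rewrite weval_cons IHv /word_ab big_cons ext_inclD.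
  by rewrite freegU_sign signed_ext_incl.
have [T [_ TE]] := free_eval w f.
have TQ : T (sph_boundary Q) = ext_incl fP (cell_d2 (P := A) (sph_hurewicz Q)).
  rewrite TE; elim: Q => [|[[u c] e] Q IHQ].
    by rewrite /sph_eval /sph_hurewicz !big_nil [cell_d2 _]raddf0 ext_incl0.
  rewrite /sph_eval /sph_hurewicz !big_cons [cell_d2 _]raddfD ext_inclD.
  rewrite -/(sph_eval f Q) IHQ; congr (_ * _).
  rewrite !fw signed_ext_incl ext_inclC mulgK; congr (ext_incl _ _).
  exact/esym/cell_d2_sg.
move=> Q1; apply: (@ext_incl_inj _ _ _ fP).
by rewrite -TQ Q1 gmulf1 ext_incl0.
Qed.

Definition bar_word (v : word (gen P)) : bar_ext G :=
  weval (fun x => bar_lift (pgen x)) v.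

(** Multiplying lifts letter by letter, each letter contributes one cocycle value; these are the
    summands of [bar_chain]. *)
Lemma bar_word_chain p v :
  bar_lift p * bar_word v
    = bar_incl (bar_pi G (bar_chain p v)) * bar_lift (p * pclass v).
Proof.
elim: v p => [|[x b] v IHv] p.
  by rewrite /bar_word weval_nil mulg1 raddf0 ext_incl0 mul1g [p * _]mulg1.
rewrite /bar_word weval_cons mulgA -/(bar_word v) -cat1s pclass_cat mulgA.
case: b => /=.
  rewrite [bar_lift p * _](ext_liftM (bar_cocycleP G)) -mulgA IHv mulgA.
  by rewrite -ext_inclD raddfD.
have -> : bar_lift p * (bar_lift (pgen x))^-1
    = bar_incl (- bar_cocycle (p * (pgen x)^-1) (pgen x))%R
      * bar_lift (p * (pgen x)^-1).
  apply: (mulIg (bar_lift (pgen x))); rewrite mulgVK -mulgA.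
  rewrite [bar_lift _ * bar_lift _](ext_liftM (bar_cocycleP G)) mulgA.
  by rewrite -ext_inclD addNr ext_incl0 mul1g mulgVK.
rewrite -mulgA IHv mulgA -ext_inclD -raddfN -raddfD.
by rewrite -[pclass [:: _]]/(pclass (inv_word [:: (x, true)])) pclass_inv.
Qed.

Lemma bar_word_relator c :
  bar_word (relator c) = bar_incl (bar_pi G (bar_chain 1 (relator c))).
Proof.
apply: (mulgI (bar_lift 1)); rewrite bar_word_chain pclass_relator mulg1.
exact: ext_inclC.
Qed.

(** The prefixes telescope, so only the first and the last remain. *)
Lemma bar_d2_chain p v : (bar_d2 G (bar_chain p v)
  = freeg_lift (fun x => << pgen x >> : bar1 G) (word_ab v)
    + << p >> - << (p * pclass v)%g >>)%R.
Proof.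
elim: v p => [|[x b] v IHv] p.
  by rewrite /word_ab big_nil !raddf0 add0r [(p * _)%g]mulg1 subrr.
rewrite -cat1s pclass_cat mulgA /word_ab big_cat big_seq1 /= -/(word_ab v).
rewrite raddfD /= freeg_lift_sg; case: b => /=.
  rewrite raddfD IHv bar_d2U /= -[pclass [:: _]]/(pgen x) !addrA.
  by rewrite [LHS](ACl (1*4*3*6*(2*5)))%R /= addNr addr0.
have -> : pclass [:: (x, false)] = (pgen x)^-1 :> G.
  by rewrite -pclass_inv.
rewrite raddfD raddfN IHv bar_d2U /= mulgVK opprD opprB !addrA.
by rewrite [LHS](ACl (2*4*1*6*(3*5)))%R /= addNr addr0.
Qed.

Variables (C : xmod G) (r : C) (beta : {ghom C -> bar_xmod G}).
Hypotheses (betaP : xmod_morphism (C := C) (D := bar_xmod G) beta idfun)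
  (betar : beta r = bar_word w).

(** Evaluate [Q] in the bar extension. Entries of the attached cell give the image of [sph_push],
    entries of old cells are central and give the bar chain, and the total is 1; hence the sign. *)
Lemma beta_sph_push Q : sph_boundary Q = 1 ->
  beta (sph_push r Q)
    = bar_incl (- bar_pi G (cell_to_bar (old_part w (sph_hurewicz Q))))%R.
Proof.
have [T [_ TE]] := free_eval w (fun x => bar_lift (pgen x)).
have TQ : T (sph_boundary Q) = beta (sph_push r Q)
    * bar_incl (bar_pi G (cell_to_bar (old_part w (sph_hurewicz Q)))).
  rewrite TE; elim: Q => [|[[u c] e] Q IHQ].
    rewrite /sph_eval /sph_push /sph_hurewicz !big_nil gmulf1 mul1g.
    by rewrite !raddf0 ext_incl0.
  rewrite /sph_eval /sph_push /sph_hurewicz !big_cons gmulfM !raddfD /=.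
  rewrite ext_inclD -/(sph_eval _ Q) IHQ.
  rewrite -/(sph_push r Q) -/(sph_hurewicz Q) -!/(bar_word _) !mulgA.
  congr (_ * _); rewrite -[RHS]mulgA -ext_inclC mulgA; congr (_ * _).
  case: c => [c|] /=; last first.
    rewrite freeg_lift_sg /= oppr0 if_same raddf0 raddf0.
    rewrite ext_incl0 mulg1 betaP.2 /= -betar.
    have -> : signed (beta r) e = beta (signed r e).
      by case: e => //=; rewrite gmulfV.
    have := @peiffer _ (bar_xmod G) (bar_word u) (beta (signed r e)).
    by rewrite [X in act X]ghom_weval.
  rewrite gmulf1 mul1g bar_word_relator signed_ext_incl -ext_inclC mulgK.
  congr (ext_incl _ _); rewrite freeg_lift_sg.
  case: e; rewrite ?raddfN /= [cell_to_bar _]freeg_liftU //.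
move=> Q1; apply: (mulIg (bar_incl (bar_pi G
  (cell_to_bar (old_part w (sph_hurewicz Q)))))).
by rewrite -TQ Q1 gmulf1 -ext_inclD addNr ext_incl0.
Qed.

End CanonicalEvaluation.

(** * Second homology of braid groups and the kernel *)

Section Main.
Variable m : nat.
Local Notation B := (braid_group m.+3).
Local Notation P := (braid_presentation m.+3).

(** Braid relators have exponent sum zero, whereas the attached cell has boundary of degree 1. *)
Lemma braid_cell_d2_deg (z : {freeg (rel_index P) / int}) :
  deg (cell_d2 (P := P) z) = 0%R.
Proof.
move: z; apply: (eq_freeg_additive (f := @deg _ \o cell_d2 (P := P))
  (g := fun => 0%R)).
- by move=> a b; rewrite /= raddfB /= degB.
- by move=> a b; rewrite subr0.
case=> [[i k] ik]; rewrite /= [cell_d2 _]freeg_liftU /=.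
rewrite /braid_relator /=.
by case: ifP => _; rewrite !big_cons big_nil !degD !degU deg0.
Qed.

Section Canonical.
Variables (j : 'I_m.+3.-1) (C : xmod B) (r : C).
Hypotheses (Cfree : xmod_free (fun _ : unit => r)) (rj : bd C r = sigma j).
Local Notation w := ([:: (j, true)] : word (gen P)).

(** The entries of the attached cell spell a word that is trivial in the braid group; old cells,
    which push to 1, cancel its boundary in the free group. *)
Lemma generated_spherical c : generated_by (P := P) r c -> kernel c ->
  exists2 Q : spherical w, sph_boundary Q = 1 & sph_push r Q = c.
Proof.
case=> s -> sK.
pose Q0 : spherical w := [seq (q.1, None, q.2) | q <- s].
have pushQ0 : sph_push r Q0 = conj_prod (P := P) r s.
  by rewrite /sph_push /conj_prod big_map.
have [T [Tu TE]] := free_eval w (@pgen P).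
have TQ0 : T (sph_boundary Q0) = 1.
  rewrite TE -[RHS]sK /sph_eval /conj_prod big_map gmulf_prod.
  apply: eq_bigr => q _; rewrite bd_act.
  have -> : weval (@pgen P) (@relator (attach w) None) = sigma j.
    by rewrite [LHS]weval_cons weval_nil mulg1.
  by case: q.2; rewrite /= ?gmulfV rj.
pose v : word (gen P) := repr (sph_boundary Q0).
have vE : weval (@free_gen (gen P)) v = sph_boundary Q0.
  by rewrite [LHS](@weval_pgen (free_presentation (gen P))) pclassK.
(* With the empty word on the left, the boundary of [Q1] is the inverse of that of [Q0]. *)
have /relators_spherical-/(_ w)[Q1 Q1old] : word_eq [::] v.
  apply/pclassP; rewrite -weval_pgen -weval_pgen -!Tu vE TQ0.
  by rewrite weval_nil gmulf1.
rewrite weval_nil mul1g vE => Q1E.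
exists (Q0 ++ Q1); first by rewrite sph_boundary_cat Q1E mulgV.
rewrite [LHS]big_cat /= -[X in X * _]/(sph_push r Q0) pushQ0 -[RHS]mulg1.
congr (_ * _); elim: Q1 Q1old {Q1E} => [|[[u [d|]] e] Q IHQ] //=.
  by rewrite big_nil.
by rewrite big_cons => /IHQ ->; rewrite mulg1.
Qed.

(** Comparing degrees in the cycle equation shows that the attached cell occurs with coefficient
    zero. *)
Lemma spherical_cycle (Q : spherical w) : sph_boundary Q = 1 ->
  exists2 z, cell_d2 (P := P) z = 0%R & sph_hurewicz Q = cell_incl w z.
Proof.
move=> /sph_boundary_ab; set a := sph_hurewicz Q; set z := old_part w a.
rewrite {1}(old_part_decomp a) raddfD /= -/z.
have -> : cell_d2 (P := attach w) (cell_incl w z) = cell_d2 (P := P) z.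
  move: z; apply: (eq_freeg_additive (f := @cell_d2 (attach w) \o cell_incl w)
    (g := @cell_d2 P)) => [x y|x y|c] /=; rewrite ?raddfB //.
  by rewrite [cell_incl w _]freeg_liftU [LHS]freeg_liftU [RHS]freeg_liftU.
have -> k : cell_d2 (P := attach w) << k *g None >>%R = << k *g j >>%R.
  rewrite -[k]intz -!freegU_mulz raddfMz /= [cell_d2 _]freeg_liftU /=.
  by rewrite big_seq1.
move=> az; have k0 : coeff None a = 0%R.
  move/(congr1 (@deg _)): (az).
  by rewrite degD braid_cell_d2_deg degU add0r deg0.
exists z; first by move: az; rewrite k0 freegU0 addr0.
by rewrite {1}(old_part_decomp a) k0 freegU0 addr0.
Qed.

Lemma cell_to_bar_cycle z :
  cell_d2 (P := P) z = 0%R -> bar_d2 B (cell_to_bar (P := P) z) = 0%R.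
Proof.
pose L : {additive {freeg (gen P) / int} -> bar1 B} :=
  freeg_lift (fun x => << pgen x >>%R : bar1 B).
have -> : bar_d2 B (cell_to_bar (P := P) z) = L (cell_d2 (P := P) z).
  move: z; apply: (eq_freeg_additive (f := bar_d2 B \o @cell_to_bar P)
    (g := L \o @cell_d2 P)) => [x y|x y|c] /=; rewrite ?raddfB //.
  rewrite [cell_to_bar _]freeg_liftU [cell_d2 _]freeg_liftU bar_d2_chain.
  by rewrite pclass_relator mulg1 addrK.
by move=> ->; rewrite raddf0.
Qed.

Lemma braid_canonical_iso :
  exists iso : H2 B -> C, canonical_iso (P := P) w r iso.
Proof.
have [beta betaP betar] := free_to_bar Cfree rj.
have beta_inj := free_to_bar_inj Cfree rj betaP.
have beta_gen b : bar_d2 B b = 0%R ->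
    exists2 c, generated_by (P := P) r c & beta c = bar_incl (bar_pi B b).
  move=> b0; apply: (free_to_bar_generated betaP betar).
  by apply: generated_cycle b0; apply: bar_full.
have beta_ker c : (exists x, beta c = bar_incl x) -> kernel c.
  by case=> x cx; rewrite /kernel -[LHS]betaP.1 cx.
(* The sign is dictated by [beta_sph_push]. *)
have /choice[iso isoE] : forall h, exists c, beta c = bar_incl (- H2_bar h)%R.
  move=> h; have [|c _ cE] := beta_gen (- val (repr h))%R.
    by rewrite raddfN H2_cycle oppr0.
  by exists c; rewrite cE raddfN.
have iso_uniq h c : beta c = bar_incl (- H2_bar h)%R -> iso h = c.
  by move=> ch; apply: beta_inj; rewrite isoE.
have canon h c : canonical_rel (P := P) w r h c -> iso h = c.
  case=> Q [z [Q1 <- z0 Qz hz]]; apply: iso_uniq.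
  rewrite (beta_sph_push betaP) //; last first.
    by rewrite betar /bar_word weval_cons weval_nil mulg1.
  by rewrite Qz old_partK (H2_classE hz).
exists iso; split=> //.
- move=> x y; apply: iso_uniq; rewrite gmulfM !isoE -ext_inclD.
  by rewrite H2_barD opprD.
- move=> h h' /(congr1 beta); rewrite !isoE.
  by move=> /ext_incl_inj/oppr_inj/H2_bar_inj.
- move=> c; split=> [cK|[h <-]]; last by apply: beta_ker; eexists; apply: isoE.
  have [b b0 cb] := free_to_bar_cycle Cfree rj betaP cK.
  have [|h hb] := @H2_class_ex _ (- b)%R; first by rewrite raddfN b0 oppr0.
  by exists h; apply: iso_uniq; rewrite cb (H2_classE hb) raddfN opprK.
move=> h c; split=> [/canon //|hc].
have cb : beta c = bar_incl (- H2_bar h)%R by rewrite -hc isoE.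
have cK : kernel c by apply: beta_ker; eexists; apply: cb.
have cgen : generated_by (P := P) r c.
  have [|d dgen dE] := beta_gen (- val (repr h))%R.
    by rewrite raddfN H2_cycle oppr0.
  by rewrite (_ : c = d) //; apply: beta_inj; rewrite cb dE raddfN.
(* Some class [h'] is canonically related to [c]; the direction already proved and injectivity give
   [h = h']. *)
have [Q Q1 Qc] := generated_spherical cgen cK.
have [z z0 Qz] := spherical_cycle Q1.
have [h' h'z] := H2_class_ex (cell_to_bar_cycle z0).
have canon' : canonical_rel (P := P) w r h' c by exists Q, z.
suff -> : h = h' by [].
apply/H2_bar_inj/oppr_inj/(@ext_incl_inj _ _ _ (bar_cocycleP B)).
by rewrite -!isoE hc (canon _ _ canon').
Qed.

Lemma free_kernel_generated c : kernel c -> generated_by (P := P) r c.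
Proof.
move=> cK; have [beta betaP betar] := free_to_bar Cfree rj.
have [b b0 cb] := free_to_bar_cycle Cfree rj betaP cK.
have bN : generated_by (P := P) (bar_lift (sigma j) : bar_xmod B)
    (bar_incl (bar_pi B b)).
  by apply: generated_cycle b0; apply: bar_full.
have [d dN dE] := free_to_bar_generated betaP betar bN.
rewrite (_ : c = d) //; apply: (free_to_bar_inj Cfree rj betaP).
by rewrite cb dE.
Qed.

End Canonical.

(** [braid_kernel] applies to the bar extension itself: a homology class is a kernel element there,
    generated by the lift of sigma_1 because it is a cycle. *)
Lemma H2_braid_cases (h : H2 B) :
  h = 0%R \/ 0 < m /\ bar_incl (H2_bar h)
    = braid_comm (bar_lift (sg m 0) : bar_xmod B).
Proof.
have full := bar_full (inord 0 : 'I_m.+3.-1).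
have := generated_cycle full (H2_cycle h); rewrite -/(H2_bar h) => hN.
have [h1|] := @braid_kernel m (bar_xmod B) (bar_lift (sg m 0)) erefl _ hN erefl.
  left; apply/H2_bar_inj/(@ext_incl_inj _ _ _ (bar_cocycleP B)).
  by rewrite h1 H2_bar0 ext_incl0.
by right.
Qed.

Lemma H2_braid_comm : 0 < m -> exists h : H2 B,
  bar_incl (H2_bar h) = braid_comm (bar_lift (sg m 0) : bar_xmod B).
Proof.
move=> m_gt0; have s02 : sg m 0 * sg m 2 = sg m 2 * sg m 0 by apply: sg_comm.
(* The standard cycle of a commuting pair; in the bar extension it becomes the commutator of the two
   lifts. *)
pose b : bar2 B := (<< (sg m 2, sg m 0) >> - << (sg m 0, sg m 2) >>)%R.
have [|h hb] := @H2_class_ex _ b.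
  apply/eqP; rewrite raddfB /= !bar_d2U s02 subr_eq0.
  by rewrite addrAC [X in _ == X]addrAC [X in (X - _)%R]addrC.
exists h; rewrite (H2_classE hb) raddfB.
rewrite -[RHS]/(bar_lift (sg m 2) * bar_lift (sg m 0) * (bar_lift (sg m 2))^-1
  * (bar_lift (sg m 0))^-1).
apply: (mulIg (bar_lift (sg m 0) * bar_lift (sg m 2))).
rewrite [in RHS]mulgA mulgVK mulgVK.
rewrite 2![bar_lift _ * bar_lift _](ext_liftM (bar_cocycleP B)).
by rewrite mulgA -ext_inclD subrK s02.
Qed.

Lemma H2_braid_order2 : 0 < m -> cyclic_of_order 2 (H2 B).
Proof.
move=> m_gt0; have [h hE] := H2_braid_comm m_gt0; exists h.
have hxh x : x = 0%R \/ x = h.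
  have [|[_]] := H2_braid_cases x; first by left.
  by rewrite -hE => /ext_incl_inj/H2_bar_inj; right.
have h0 : h <> 0%R.
  move=> h0; apply: (bar_braid_comm_neq1 m_gt0).
  by rewrite -hE h0 H2_bar0 ext_incl0.
have hh : (h + h = 0)%R.
  have [//|hhh] := hxh (h + h)%R.
  by case: h0; apply: (addrI h); rewrite addr0.
split=> [x|k].
  by have [->|->] := hxh x; [exists 0%R | exists 1%R]; rewrite ?mulr0z ?mulr1z.
have {1}-> : (h *~ k = h *~ (k %% 2)%Z)%R.
  rewrite {1}(divz_eq k 2) mulrzDr (mulrC _ 2%R) mulrzA.
  by rewrite -[(h *~ 2)%R]/(h + h)%R hh mul0rz add0r.
have : ((k %% 2)%Z < 2)%R by rewrite ltz_pmod.
have : (0 <= (k %% 2)%Z)%R by rewrite modz_ge0.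
case kE : (k %% 2)%Z => [[|[|k']]|] // _ _.
  by split=> // _; apply/dvdz_mod0P.
by split=> // /dvdz_mod0P; rewrite kE.
Qed.

(** The kernel consists of 1 and the relation, so it equals both the subgroup generated by the
    relation and its normal closure. *)
Lemma braid_xmod_relation (C : xmod B) (r : C) (j1 j3 : 'I_m.+3.-1) :
    0 < m -> j1 = 0 :> nat -> j3 = 2 :> nat ->
    xmod_free (fun _ : unit => r) -> bd C r = sigma j1 ->
    let relation (c : C) := c = (act (sigma j3) r * r^-1)%g in
    (forall c : C, kernel c <-> generated_subgroup relation c)
    /\ xmod_quotient (D := self_xmod B) (normal_closure relation) (bd C).
Proof.
move=> m_gt0 j10 j32 Cfree rj relation.
have r0 : bd C r = sg m 0 by rewrite rj -sg_ord j10.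
have relE c : relation c <-> c = braid_comm r.
  by rewrite /relation /braid_comm -sg_ord j32.
have relK c : relation c -> kernel c.
  by move/relE ->; apply: braid_comm_kernel.
have kerE c : kernel c -> c = 1 \/ c = braid_comm r.
  move=> cK; have cN := free_kernel_generated Cfree rj cK.
  by have [->|[_ ->]] := braid_kernel r0 cN cK; [left | right].
split=> [c|].
  split=> [/kerE[->|->] N [N1 NM NV] relN //|].
    by apply: relN; apply/relE.
  by move/(_ (@kernel _ C)); apply; [apply: kernel_subgroup | apply: relK].
split.
- by split=> // x c; rewrite bd_act.
- by move=> d; have [c _ cd] := braid_image_full r0 d; exists c.
move=> c; split=> [cK N [N1 NM NV] NJ Nact relN|].
  by have [->|->] := kerE c cK; [ | apply: relN; apply/relE].
move/(_ (@kernel _ C)); apply; first exact: kernel_subgroup.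
- by move=> d e eK; rewrite /kernel !gmulfM gmulfV eK mulg1 mulgV.
- by move=> x e eK; rewrite /kernel bd_act eK mulg1 mulgV.
exact: relK.
Qed.

End Main.

Theorem theorem5p1 (n : nat) (n_ge3 : 3 <= n) :
  [/\ forall (j : 'I_n.-1) (C : xmod (braid_group n)) (r : C),
        xmod_free (fun _ : unit => r) -> bd C r = sigma j ->
        (forall c : C, kernel c -> forall d : C, (c * d = d * c)%g)
        /\ exists iso : H2 (braid_group n) -> C,
             canonical_iso (P := braid_presentation n) [:: (j, true)] r iso,
      n = 3 -> forall h : H2 (braid_group n), h = 0%R,
      4 <= n -> cyclic_of_order 2 (H2 (braid_group n))
    & 4 <= n -> forall (j1 j3 : 'I_n.-1), j1 = 0 :> nat -> j3 = 2 :> nat ->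
        forall (C : xmod (braid_group n)) (r : C),
        xmod_free (fun _ : unit => r) -> bd C r = sigma j1 ->
        let relation (c : C) := c = (act (sigma j3) r * r^-1)%g in
        (forall c : C, kernel c <-> generated_subgroup relation c)
        /\ xmod_quotient (D := self_xmod (braid_group n))
             (normal_closure relation) (bd C)].
Proof.
(* With [n = m.+3], the condition [4 <= n] becomes [0 < m]. *)
case: n n_ge3 => [//|[//|[//|m]]] _; split.
- move=> j C r Cfree rj; split; last exact: braid_canonical_iso Cfree rj.
  by move=> c cK d; apply: kernel_central.
- move=> [m0] h; case: (H2_braid_cases h) => // -[m_gt0 _].
  by move: m_gt0; rewrite {1}m0.
- exact: H2_braid_order2.
by move=> m_gt0 j1 j3 j10 j32 C r; apply: braid_xmod_relation.
Qed.
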